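(* Let $(A,\phi)$ be a non-commutative probability space with unital linear map $\phi:A\to k$, and let $\Phi:H=\overline T(T(A))\to k$ be its extension as a character. Let $\rho:\overline T(T(A))\to k$ be the infinitesimal character solving $\Phi=\exp^*(\rho)$, i.e. $\rho=\log^*(\Phi)$. For a word $w=a_1\cdots a_n\in T(A)$ set $h_n(a_1,\ldots,a_n):=\rho(w)$ and $m_n(a_1,\ldots,a_n):=\Phi(w)$. Then $$\Phi(w)=\sum_{s=1}^n\frac1{s!}\sum_{\gamma\in\mathcal{NC}_n^s}\mathrm m(\gamma)\,h_\gamma(a_1,\ldots,a_n),$$ where $\mathcal{NC}_n^s$ is the set of non-crossing partitions of $[n]$ with $s$ blocks and $\mathrm m(\gamma)$ is the number of monotone labellings of $\gamma$. In particular, $h_n(a_1,\ldots,a_n)$ is the $n$-th multivariate monotone cumulant map.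
   Context: $k$ is a field of characteristic zero. A non-commutative probability space $(A,\phi)$ is an associative unital $k$-algebra $A$ (product $\cdot_A$, unit $1_A$) with a $k$-linear form $\phi:A\to k$ with $\phi(1_A)=1$. Double tensor algebra. $T(A)=\bigoplus_{n>0}A^{\otimes n}$ and $\overline T(A)=\bigoplus_{n\ge0}A^{\otimes n}$; the tensor $a_1\otimes\cdots\otimes a_n$ is written as a word $a_1\cdots a_n$ (not to be confused with the product $a_1\cdot_A\cdots\cdot_A a_n$ in $A$). $H:=\overline T(T(A))=\bigoplus_{n\ge0}T(A)^{\otimes n}$ is the unital algebra spanned by bar words $w_1|\cdots|w_m$ ($w_i\in T(A)$), with product the concatenation $|$ and unit $\mathbf 1$ (the empty word is identified with $\mathbf 1$); it is graded by the total number of letters. $H^+:=T(T(A))=\bigoplus_{n>0}T(A)^{\otimes n}$. Coproduct. For $S=\{s_1<\cdots<s_p\}\subseteq[n]=\{1,\dots,n\}$ put $a_S:=a_{s_1}\cdots a_{s_p}$, $a_\emptyset:=\mathbf 1$. If $J_1,\dots,J_l$ are the connected components (maximal intervals of consecutive integers, in increasing order) of $[n]\setminus S$, put $a_{J^S_{[n]}}:=a_{J_1}|\cdots|a_{J_l}$ ($=\mathbf 1$ if $S=[n]$). The coproduct $\Delta:H\to H\otimes H$ is given by $\Delta(\mathbf 1)=\mathbf 1\otimes\mathbf 1$, $\Delta(a_1\cdots a_n)=\sum_{S\subseteq[n]}a_S\otimes a_{J^S_{[n]}}$, and is extended multiplicatively to $H$. It is known that $H$ is a connected graded Hopf algebra;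 its counit is denoted $\epsilon$. Characters. On $\mathcal L_A:=Lin(H,k)$ the convolution product is $f*g:=m_k\circ(f\otimes g)\circ\Delta$ ($m_k$ the product of $k$), with unit $\epsilon$. A character is $\Phi\in\mathcal L_A$ with $\Phi(\mathbf 1)=1$ and $\Phi(w_1|w_2)=\Phi(w_1)\Phi(w_2)$ for $w_1,w_2\in H$. An infinitesimal character is $\kappa\in\mathcal L_A$ with $\kappa(\mathbf 1)=0$ and $\kappa(w_1|w_2)=0$ for $w_1,w_2\in H^+$. The maps $\exp^*(\alpha)=\sum_{j\ge0}\frac1{j!}\alpha^{*j}$ and $\log^*(\epsilon+\gamma)=\sum_{l\ge1}\frac{(-1)^{l-1}}{l}\gamma^{*l}$ (finite sums when evaluated on any element) are mutually inverse bijections between infinitesimal characters and characters. Extension of $\phi$. $\phi$ is extended to $T(A)$ by $\phi(a_1\cdots a_n):=\phi(a_1\cdot_A\cdots\cdot_A a_n)$, and then to the character $\Phi$ by $\Phi(\mathbf 1)=1$, $\Phi(w_1|\cdots|w_m):=\phi(w_1)\cdots\phi(w_m)$. Partitions. A partition of $[n]$ into nonempty blocks is non-crossing if there are no two distinct blocks $\pi_a\neq\pi_b$ and elements $i,l\in\pi_a$, $j,m\in\pi_b$ with $i<j<l<m$. For a non-crossing partition $\gamma$, $h_\gamma(a_1,\dots,a_n):=\prod_{\gamma_i\in\gamma}h_{|\gamma_i|}(a_{\gamma_i})$, where for a block $\gamma_i=\{j_1<\cdots<j_p\}$, $|\gamma_i|=p$ and $h_p(a_{\gamma_i}):=h_p(a_{j_1},\dots,a_{j_p})$.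 The blocks of $\gamma$ are partially ordered by: $\gamma_i\ge\gamma_j$ iff there exist $a,b\in\gamma_j$, $c\in\gamma_i$ with $a\le c\le b$. A monotone labelling of $\gamma$ is a total order of its blocks refining this partial order (a linear extension); a non-crossing partition with a monotone labelling is a monotone partition. The multivariate monotone cumulants are the multilinear maps $h_n$ uniquely determined by the moment–cumulant relation $\phi(a_1\cdot_A\cdots\cdot_A a_n)=\sum\frac1{s!}h_\gamma(a_1,\dots,a_n)$, the sum running over all monotone partitions of $[n]$, $\gamma$ being the underlying non-crossing partition and $s$ its number of blocks. *)

(* Defs.v *)
From HB Require Import structures.
From mathcomp Require Import boolp classical_sets cardinality fsbigop.
From mathcomp Require Import all_boot all_order all_algebra.
From mathcomp Require Import generic_quotient ring_quotient finmap monalg.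

Set Implicit Arguments.
Unset Strict Implicit.
Unset Printing Implicit Defensive.

Import GRing.Theory.
Local Open Scope ring_scope.
Local Open Scope quotient_scope.

Lemma lin0 (k : fieldType) (U W : lmodType k) (f : U -> W) :
  linear f -> f 0 = 0.
Proof.
by move=> hl; have := hl (-1) 0 0; rewrite scaler0 addr0 scaleN1r addNr.
Qed.

Lemma linZ (k : fieldType) (U W : lmodType k) (f : U -> W) c x :
  linear f -> f (c *: x) = c *: f x.
Proof. by move=> fl; rewrite -[c *: x]addr0 fl lin0 // addr0. Qed.

Lemma comb_swap (k : fieldType) (U : lmodType k) c d (u v w z : U) :
  d *: (c *: u + v) + (c *: w + z) = c *: (d *: u + w) + (d *: v + z).
Proof. by rewrite !scalerDr !scalerA (mulrC d) addrACA. Qed.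

Section Presentation.
Variables (k : fieldType) (K : choiceType) (R : {malg k[K]} -> Prop).

Inductive relspan : {malg k[K]} -> Prop :=
| relspan0 : relspan 0
| relspanP c r g : R r -> relspan g -> relspan (c *: r + g).

Definition relators : {pred {malg k[K]}} := fun g => `[< relspan g >].

Lemma relspanD g1 g2 : relspan g1 -> relspan g2 -> relspan (g1 + g2).
Proof.
elim=> [|c r g Rr _ IH] h2; first by rewrite add0r.
by rewrite -addrA; apply: relspanP => //; apply: IH.
Qed.

Lemma relspanZ c g : relspan g -> relspan (c *: g).
Proof.
elim=> [|d r g' Rr _ IH]; first by rewrite scaler0; apply: relspan0.
by rewrite scalerDr scalerA; apply: relspanP.
Qed.

Lemma relators_zmod : zmod_closed relators.
Proof.
split; first by apply/asboolP; apply: relspan0.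
move=> x y /asboolP hx /asboolP hy; apply/asboolP; apply: relspanD => //.
by rewrite -scaleN1r; apply: relspanZ.
Qed.

HB.instance Definition _ := GRing.isZmodClosed.Build _ relators relators_zmod.

(* The k-module with generators K and relators R. *)
Definition presented := Quotient.quot relators.
HB.instance Definition _ := Choice.on presented.

End Presentation.

HB.lock Definition pclass (k : fieldType) (K : choiceType)
  (R : {malg k[K]} -> Prop) (g : {malg k[K]}) : presented R :=
  \pi_(presented R) g.

HB.lock Definition prepr (k : fieldType) (K : choiceType)
  (R : {malg k[K]} -> Prop) (x : presented R) : {malg k[K]} := repr x.

HB.lock Definition padd (k : fieldType) (K : choiceType)
  (R : {malg k[K]} -> Prop) (x y : presented R) : presented R :=
  pclass R (prepr x + prepr y).

HB.lock Definition pscale (k : fieldType) (K : choiceType)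
  (R : {malg k[K]} -> Prop) (c : k) (x : presented R) : presented R :=
  pclass R (c *: prepr x).

Section PresentedModule.
Variables (k : fieldType) (K : choiceType) (R : {malg k[K]} -> Prop).
Local Notation presented := (presented R).
Local Notation pclass := (@pclass k K R).
Local Notation relspan := (relspan R).
Local Notation padd := (@padd k K R).
Local Notation pscale := (@pscale k K R).

Lemma pclass_eq g1 g2 : relspan (g1 - g2) -> pclass g1 = pclass g2.
Proof.
by move=> h; apply/eqP; rewrite unlock -Quotient.idealrBE; apply/asboolP.
Qed.

Lemma pclass_rel g1 g2 : pclass g1 = pclass g2 -> relspan (g1 - g2).
Proof. by move/eqP; rewrite unlock -Quotient.idealrBE => /asboolP. Qed.

Lemma preprK (x : presented) : pclass (prepr x) = x.
Proof. by rewrite pclass.unlock prepr.unlock reprK. Qed.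

Lemma pclass_padd g1 g2 : pclass (g1 + g2) = padd (pclass g1) (pclass g2).
Proof.
rewrite padd.unlock; apply: pclass_eq; rewrite opprD addrACA.
by apply: relspanD; apply: pclass_rel; rewrite preprK.
Qed.

Lemma pclass_pscale c g : pclass (c *: g) = pscale c (pclass g).
Proof.
rewrite pscale.unlock; apply: pclass_eq; rewrite -scalerBr; apply: relspanZ.
by apply: pclass_rel; rewrite preprK.
Qed.

Lemma paddA : associative padd.
Proof.
move=> x y z; rewrite -[x]preprK -[y]preprK -[z]preprK.
by rewrite -!pclass_padd addrA.
Qed.
Lemma paddC : commutative padd.
Proof. by move=> x y; rewrite -[x]preprK -[y]preprK -!pclass_padd addrC. Qed.
Lemma padd0 : left_id (pclass 0) padd.
Proof. by move=> x; rewrite -[x]preprK -pclass_padd add0r. Qed.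
Lemma paddN : left_inverse (pclass 0) (pscale (-1)) padd.
Proof.
move=> x; rewrite -[x]preprK -pclass_pscale -pclass_padd.
by rewrite scaleN1r addNr.
Qed.
HB.instance Definition _ :=
  GRing.isZmodule.Build presented paddA paddC padd0 paddN.

Lemma pscaleA a b v : pscale a (pscale b v) = pscale (a * b) v.
Proof. by rewrite -[v]preprK -!pclass_pscale scalerA. Qed.
Lemma pscale1 : left_id 1 pscale.
Proof. by move=> v; rewrite -[v]preprK -pclass_pscale scale1r. Qed.
Lemma pscaleDr : right_distributive pscale +%R.
Proof.
move=> a u v; rewrite -[u]preprK -[v]preprK -[X in pscale _ X]pclass_padd.
by rewrite -!pclass_pscale scalerDr pclass_padd.
Qed.
Lemma pscaleDl v : {morph pscale^~ v : a b / a + b}.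
Proof.
by move=> a b; rewrite -[v]preprK -!pclass_pscale scalerDl pclass_padd.
Qed.
HB.instance Definition _ :=
  GRing.Zmodule_isLmodule.Build k presented pscaleA pscale1 pscaleDr pscaleDl.

Lemma pclassD g1 g2 : pclass (g1 + g2) = pclass g1 + pclass g2.
Proof. exact: pclass_padd. Qed.

Lemma pclassZ c g : pclass (c *: g) = c *: pclass g.
Proof. exact: pclass_pscale. Qed.

Lemma pclass_is_linear : linear pclass.
Proof. by move=> c x y; rewrite pclassD pclassZ. Qed.
HB.instance Definition _ :=
  GRing.isLinear.Build k {malg k[K]} presented *:%R pclass pclass_is_linear.

Definition pgen (x : K) : presented := pclass << x >>.

Lemma pclass_rel0 r : R r -> pclass r = 0.
Proof.
move=> Rr; rewrite -(linear0 pclass); apply: pclass_eq; rewrite subr0.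
by rewrite -[r]scale1r -[_ *: _]addr0; apply: relspanP => //; apply: relspan0.
Qed.

Lemma pclass_comb g1 c g2 g3 :
  R (g1 - (c *: g2 + g3)) -> pclass g1 = c *: pclass g2 + pclass g3.
Proof.
move=> /pclass_rel0; rewrite linearB => /eqP; rewrite subr_eq0 => /eqP ->.
by rewrite linearP.
Qed.

Section Linext.
Variables (W : lmodType k) (f : K -> W).

Definition linext (g : {malg k[K]}) : W := \sum_(x <- msupp g) g@_x *: f x.

Lemma linextEw (d : {fset K}) g : (msupp g `<=` d)%fset ->
  linext g = \sum_(x <- d) g@_x *: f x.
Proof.
move=> le; rewrite /linext (big_fset_incl _ le) // => x _ /mcoeff_outdom ->.
by rewrite scale0r.
Qed.

Lemma linext_is_linear : linear linext.
Proof.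
move=> c g1 g2; pose d := (msupp g1 `|` msupp g2 `|` msupp (c *: g1 + g2))%fset.
rewrite (@linextEw d) ?fsubsetUr // (@linextEw d g1) ?(@linextEw d g2); first last.
- by rewrite /d -fsetUA fsubsetUl.
- by rewrite /d (fsetUC (msupp g1)) -fsetUA fsubsetUl.
rewrite scaler_sumr -big_split /=; apply: eq_bigr => x _.
by rewrite mcoeffD mcoeffZ scalerDl scalerA.
Qed.
HB.instance Definition _ :=
  GRing.isLinear.Build k {malg k[K]} W *:%R linext linext_is_linear.

Lemma linextU x : linext << x >> = f x.
Proof.
by rewrite /linext msuppU oner_eq0 big_seq_fset1 mcoeffUU scale1r.
Qed.

End Linext.
End PresentedModule.

(* The map induced by f on the quotient, provided that f kills R. *)
HB.lock Definition plift (k : fieldType) (K : choiceType)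
  (R : {malg k[K]} -> Prop) (W : lmodType k) (f : K -> W)
  (x : presented R) : W := linext f (prepr x).

Section PresentedLift.
Variables (k : fieldType) (K : choiceType) (R : {malg k[K]} -> Prop).
Local Notation presented := (presented R).
Local Notation pclass := (@pclass k K R).
Local Notation relspan := (relspan R).
Local Notation pgen := (@pgen k K R).

Section Lift.
Variables (W : lmodType k) (f : K -> W).
Local Notation linext := (linext f).
Local Notation plift := (@plift k K R W f).

Hypothesis fR : forall r, R r -> linext r = 0.

Lemma plift_class g : plift (pclass g) = linext g.
Proof.
apply/eqP; rewrite plift.unlock -subr_eq0 -linearB /=.
have : relspan (prepr (pclass g) - g) by apply: pclass_rel; rewrite preprK.
elim=> [|c r g' Rr _ /eqP IH]; first by rewrite linear0.
by rewrite linearP /= fR // IH scaler0 addr0.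
Qed.

Lemma plift_is_linear : linear plift.
Proof.
move=> c x y; rewrite -[x]preprK -[y]preprK -linearP !plift_class.
exact: linearP.
Qed.

Lemma plift_gen x : plift (pgen x) = f x.
Proof. by rewrite plift_class linextU. Qed.

End Lift.

Lemma presented_ind (P : presented -> Prop) :
  P 0 -> (forall c x v, P v -> P (c *: pgen x + v)) -> forall v, P v.
Proof.
move=> P0 PS v; rewrite -[v]preprK (monalgE (prepr v)).
elim: (enum_fset _) => [|x s IH]; first by rewrite big_nil linear0.
rewrite big_cons; have ->: << (prepr v)@_x *g x >> = (prepr v)@_x *: << x >>.
  by apply/malgP=> y; rewrite mcoeffZ !mcoeffU mulr_natr.
by rewrite linearP; apply: PS.
Qed.

Lemma presented_lin_ext (W : lmodType k) (f g : presented -> W) :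
  linear f -> linear g -> (forall x, f (pgen x) = g (pgen x)) -> f =1 g.
Proof.
move=> fl gl fg; elim/presented_ind => [|c x v IH]; first by rewrite !lin0.
by rewrite fl gl IH fg.
Qed.

End PresentedLift.

Section Tensor.
Variables (k : fieldType) (V W : lmodType k).

Definition free2 (x : V) (y : W) : {malg k[(V * W)%type]} := << (x, y) >>.

Variant bilinear_rel : {malg k[(V * W)%type]} -> Prop :=
| BilinearL c x x' y :
    bilinear_rel (free2 (c *: x + x') y - (c *: free2 x y + free2 x' y))
| BilinearR c x y y' :
    bilinear_rel (free2 x (c *: y + y') - (c *: free2 x y + free2 x y')).

Definition tensor := presented bilinear_rel.
HB.instance Definition _ := GRing.Lmodule.on tensor.

End Tensor.

HB.lock Definition pure (k : fieldType) (V W : lmodType k) (x : V) (y : W) :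
  tensor V W := pgen (@bilinear_rel k V W) (x, y).

Section TensorTheory.
Variables (k : fieldType) (V W : lmodType k).
Local Notation tensor := (tensor V W).
Local Notation pure := (@pure k V W).

Lemma pureDZl c x x' y : pure (c *: x + x') y = c *: pure x y + pure x' y.
Proof. by rewrite pure.unlock; exact: (pclass_comb (BilinearL c x x' y)). Qed.

Lemma pureDZr c x y y' : pure x (c *: y + y') = c *: pure x y + pure x y'.
Proof. by rewrite pure.unlock; exact: (pclass_comb (BilinearR c x y y')). Qed.

Lemma tensor_ind (P : tensor -> Prop) :
  P 0 -> (forall c x y v, P v -> P (c *: pure x y + v)) -> forall v, P v.
Proof.
rewrite pure.unlock => P0 PS; apply: presented_ind => // c [x y] v Pv.
exact: PS.
Qed.

Section TensorLift.
Variables (U : lmodType k) (f : V -> W -> U).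

Definition tensor_lift (t : tensor) : U := plift (fun p => f p.1 p.2) t.

Hypothesis fl : forall y, linear (f^~ y).
Hypothesis fr : forall x, linear (f x).

Lemma tensor_lift_rel r :
  bilinear_rel r -> linext (fun p => f p.1 p.2) r = 0.
Proof.
by case=> *; rewrite linearB linearP /= !linextU /= (fl, fr) subrr.
Qed.

Lemma tensor_lift_is_linear : linear tensor_lift.
Proof. by apply: plift_is_linear; apply: tensor_lift_rel. Qed.

Lemma tensor_lift_pure x y : tensor_lift (pure x y) = f x y.
Proof. by rewrite /tensor_lift pure.unlock plift_gen //; apply: tensor_lift_rel. Qed.
End TensorLift.

Lemma tensor_lin_ext (U : lmodType k) (f g : tensor -> U) :
  linear f -> linear g -> (forall x y, f (pure x y) = g (pure x y)) -> f =1 g.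
Proof.
rewrite pure.unlock => fl gl fg; apply: presented_lin_ext => // -[x y].
exact: fg.
Qed.
End TensorTheory.

Notation "x ⊗ y" := (pure x y) (at level 40, left associativity).

Section TensorForms.
Variables (k : fieldType) (V W : lmodType k).
Variables (f : {linear V -> k^o}) (g : {linear W -> k^o}).

(* m_k \o (f ⊗ g) *)
Definition tensor_form : tensor V W -> k^o :=
  tensor_lift (fun x y => f x * g y : k^o).

Lemma tensor_form_bilin :
  (forall y, linear (fun x => f x * g y : k^o)) /\
  (forall x, linear (fun y => f x * g y : k^o)).
Proof.
split=> [y c x x'|x c y y']; rewrite linearP.
  by rewrite mulrDl /GRing.scale /= mulrA.
by rewrite mulrDr /GRing.scale /= mulrCA.
Qed.

Lemma tensor_form_is_linear : linear tensor_form.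
Proof. by apply: tensor_lift_is_linear; case: tensor_form_bilin. Qed.
HB.instance Definition _ :=
  GRing.isLinear.Build k (tensor V W) k^o *:%R tensor_form
    tensor_form_is_linear.

Lemma tensor_form_pure x y : tensor_form (x ⊗ y) = f x * g y.
Proof. by apply: tensor_lift_pure; case: tensor_form_bilin. Qed.
End TensorForms.

Section TensorPowers.
Variables (k : fieldType) (b : nat) (V : lmodType k).

Definition word_index := {s : seq V | (b <= size s)%N}.

Definition free_word (s : seq V) : {malg k[word_index]} :=
  if insub s is Some u then << u >> else 0.

Variant multilinear_rel : {malg k[word_index]} -> Prop :=
| Multilinear c s x y t : multilinear_rel
    (free_word (s ++ (c *: x + y) :: t)
     - (c *: free_word (s ++ x :: t) + free_word (s ++ y :: t))).

(* The direct sum of the tensor powers of V of exponent at least b: words of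
   length at least b, modulo multilinearity in each letter. *)
Definition tensor_powers := presented multilinear_rel.
HB.instance Definition _ := GRing.Lmodule.on tensor_powers.

End TensorPowers.

(* x_1 ⊗ ... ⊗ x_n if b <= n, and 0 otherwise. *)
HB.lock Definition word (k : fieldType) (b : nat) (V : lmodType k)
  (s : seq V) : tensor_powers b V := pclass (@multilinear_rel k b V) (free_word b s).

Section TensorPowersTheory.
Variables (k : fieldType) (b : nat) (V : lmodType k).
Local Notation tensor_powers := (tensor_powers b V).
Local Notation word_index := (word_index b V).
Local Notation free_word := (@free_word k b V).
Local Notation multilinear_rel := (@multilinear_rel k b V).
Local Notation word := (@word k b V).

Lemma wordDZ c s x y t : word (s ++ (c *: x + y) :: t) =
  c *: word (s ++ x :: t) + word (s ++ y :: t).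
Proof. by rewrite word.unlock; exact: (pclass_comb (Multilinear b c s x y t)). Qed.

Lemma word_pgen (u : word_index) : pgen multilinear_rel u = word (val u).
Proof. by rewrite word.unlock /free_word valK. Qed.

Lemma tensor_powers_ind (P : tensor_powers -> Prop) :
  P 0 -> (forall c s v, (b <= size s)%N -> P v -> P (c *: word s + v)) ->
  forall v, P v.
Proof.
move=> P0 PS; elim/presented_ind=> // c u v Pv.
by rewrite word_pgen; exact: PS (valP u) Pv.
Qed.

Lemma tensor_powers_lin_ext (W : lmodType k) (f g : tensor_powers -> W) :
  linear f -> linear g -> (forall s, (b <= size s)%N -> f (word s) = g (word s)) ->
  f =1 g.
Proof.
move=> fl gl fg; apply: presented_lin_ext => // u.
by rewrite word_pgen; exact: fg (valP u).
Qed.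

Section WordLift.
Variables (W : lmodType k) (f : seq V -> W).

Definition word_lift (t : tensor_powers) : W :=
  plift (fun u : word_index => f (val u)) t.

Hypothesis f_multilinear : forall c s x y t,
  f (s ++ (c *: x + y) :: t) = c *: f (s ++ x :: t) + f (s ++ y :: t).

Lemma linext_free_word s : (b <= size s)%N ->
  linext (fun u : word_index => f (val u)) (free_word s) = f s.
Proof. by move=> bs; rewrite /free_word insubT linextU. Qed.

Lemma word_lift_rel r : multilinear_rel r ->
  linext (fun u : word_index => f (val u)) r = 0.
Proof.
case=> c s x y t; rewrite linearB linearP /=.
have [bs|bs] := leqP b (size (s ++ x :: t)).
  by rewrite !linext_free_word ?f_multilinear ?subrr //; move: bs;
    rewrite !size_cat.
have sz z : free_word (s ++ z :: t) = 0.
  by rewrite /free_word insubF //; move: bs; rewrite !size_cat /= ltnNge => /negbTE.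
by rewrite !sz !linear0 ?scaler0 addr0 subrr.
Qed.

Lemma word_lift_is_linear : linear word_lift.
Proof. by apply: plift_is_linear; apply: word_lift_rel. Qed.

Lemma word_lift_word s : (b <= size s)%N -> word_lift (word s) = f s.
Proof.
move=> bs; rewrite /word_lift word.unlock plift_class ?linext_free_word //.
exact: word_lift_rel.
Qed.
End WordLift.
End TensorPowersTheory.

Section TensorAlgebra.
Variables (k : fieldType) (V : lmodType k).

Local Notation T0 := (tensor_powers 0 V).

Definition tcat (x y : T0) : T0 :=
  word_lift (fun s => word_lift (fun t => word 0 (s ++ t)) y) x.

Lemma catl_multi (t : seq V) c s x y s' :
  word 0 ((s ++ (c *: x + y) :: s') ++ t) =
  c *: word 0 ((s ++ x :: s') ++ t) + word 0 ((s ++ y :: s') ++ t).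
Proof. by rewrite -!catA /= wordDZ. Qed.

Lemma catr_multi (s : seq V) c t x y t' :
  word 0 (s ++ (t ++ (c *: x + y) :: t')) =
  c *: word 0 (s ++ (t ++ x :: t')) + word 0 (s ++ (t ++ y :: t')).
Proof. by rewrite !catA wordDZ. Qed.

Lemma tcat_multi (u : T0) c s x y t :
  word_lift (fun t' => word 0 ((s ++ (c *: x + y) :: t) ++ t')) u =
  c *: word_lift (fun t' => word 0 ((s ++ x :: t) ++ t')) u +
  word_lift (fun t' => word 0 ((s ++ y :: t) ++ t')) u.
Proof.
have L z : linear (word_lift (fun t' => word 0 ((s ++ z :: t) ++ t')) : T0 -> T0).
  exact: (word_lift_is_linear (@catr_multi (s ++ z :: t))).
elim/tensor_powers_ind: u => [|d s' u _ IH].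
  by rewrite !(lin0 (L _)) scaler0 addr0.
have E z : word_lift (fun t' => word 0 ((s ++ z :: t) ++ t')) (word 0 s') =
    word 0 ((s ++ z :: t) ++ s') :> T0.
  exact: (word_lift_word (@catr_multi (s ++ z :: t))).
rewrite (L (c *: x + y) d) (L x d) (L y d) (E x) (E y) (E (c *: x + y)).
by rewrite catl_multi IH; exact: comb_swap.
Qed.

Lemma tcat_linearl u : linear (tcat^~ u).
Proof. exact: (word_lift_is_linear (tcat_multi u)). Qed.

Lemma tcat_word s t : tcat (word 0 s) (word 0 t) = word 0 (s ++ t).
Proof.
rewrite /tcat (word_lift_word (tcat_multi _)) //.
by rewrite (word_lift_word (@catr_multi _)).
Qed.

Lemma tcat_linearr u : linear (tcat u).
Proof.
move=> c v w; elim/tensor_powers_ind: u => [|d s u _ IH].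
  by rewrite !(lin0 (tcat_linearl _)) scaler0 addr0.
have E z : tcat (word 0 s) z = word_lift (fun t => word 0 (s ++ t)) z.
  exact: (word_lift_word (tcat_multi z)).
rewrite (@tcat_linearl (c *: v + w) d) (@tcat_linearl v d) (@tcat_linearl w d).
rewrite (E v) (E w) (E (c *: v + w)) (word_lift_is_linear (@catr_multi s)) IH.
exact: comb_swap.
Qed.

Lemma tcatA : associative tcat.
Proof.
move=> x y z; elim/tensor_powers_ind: x => [|c s x _ IHx].
  by rewrite !(lin0 (tcat_linearl _)).
rewrite !(@tcat_linearl _ c) IHx; congr (_ *: _ + _) => {x IHx}.
elim/tensor_powers_ind: y => [|d t y _ IHy].
  by rewrite (lin0 (tcat_linearl _)) !(lin0 (tcat_linearr _)) (lin0 (tcat_linearl _)).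
rewrite (@tcat_linearl _ d) !(@tcat_linearr _ d) (@tcat_linearl _ d) IHy.
congr (_ *: _ + _) => {y IHy}.
elim/tensor_powers_ind: z => [|e r z _ IHz].
  by rewrite !(lin0 (tcat_linearr _)).
by rewrite !(@tcat_linearr _ e) IHz !tcat_word catA.
Qed.

Lemma tcat1l : left_id (word 0 [::]) tcat.
Proof.
move=> x; elim/tensor_powers_ind: x => [|c s x _ IH].
  by rewrite !(lin0 (tcat_linearr _)).
by rewrite (@tcat_linearr _ c) IH tcat_word.
Qed.

Lemma tcat1r : right_id (word 0 [::]) tcat.
Proof.
move=> x; elim/tensor_powers_ind: x => [|c s x _ IH].
  by rewrite !(lin0 (tcat_linearl _)).
by rewrite (@tcat_linearl _ c) IH tcat_word cats0.
Qed.

Lemma tcatDl : left_distributive tcat +%R.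
Proof. by move=> x y z; have := @tcat_linearl z 1 x y; rewrite !scale1r. Qed.

Lemma tcatDr : right_distributive tcat +%R.
Proof. by move=> z x y; have := @tcat_linearr z 1 x y; rewrite !scale1r. Qed.

Lemma tcat1_neq0 : word 0 [::] != 0 :> T0.
Proof.
pose f (s : seq V) : k^o := (s == [::])%:R.
have fm c s x y t : f (s ++ (c *: x + y) :: t) =
    c *: f (s ++ x :: t) + f (s ++ y :: t).
  by rewrite /f; case: s => [|? ?] /=; rewrite scaler0 addr0.
apply/eqP => /(congr1 (word_lift f)).
rewrite (word_lift_word fm) // (lin0 (word_lift_is_linear fm)).
by move/eqP; rewrite oner_eq0.
Qed.

Definition Tbar := T0.
HB.instance Definition _ := GRing.Lmodule.on Tbar.

HB.instance Definition _ := GRing.Zmodule_isNzRing.Build Tbar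
  tcatA tcat1l tcat1r tcatDl tcatDr tcat1_neq0.

Lemma tcatZl c (x y : Tbar) : c *: (x * y) = (c *: x) * y.
Proof. by symmetry; exact: (linZ c x (@tcat_linearl y)). Qed.
HB.instance Definition _ := GRing.Lmodule_isLalgebra.Build k Tbar tcatZl.

Lemma tcatZr c (x y : Tbar) : c *: (x * y) = x * (c *: y).
Proof. by symmetry; exact: (linZ c y (@tcat_linearr x)). Qed.
HB.instance Definition _ := GRing.Lalgebra_isAlgebra.Build k Tbar tcatZr.

Definition tword (s : seq V) : Tbar := word 0 s.

Lemma tword_cat s t : tword (s ++ t) = tword s * tword t.
Proof. by symmetry; exact: tcat_word. Qed.

Lemma tword0 : tword [::] = 1.
Proof. by []. Qed.

Lemma tword_multi c s x y t :
  tword (s ++ (c *: x + y) :: t) = c *: tword (s ++ x :: t) + tword (s ++ y :: t).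
Proof. exact: wordDZ. Qed.

Lemma Tbar_ind (P : Tbar -> Prop) :
  P 0 -> (forall c s v, P v -> P (c *: tword s + v)) -> forall v, P v.
Proof. by move=> P0 PS; elim/tensor_powers_ind=> // c s v _; apply: PS. Qed.

Lemma Tbar_lin_ext (W : lmodType k) (f g : Tbar -> W) :
  linear f -> linear g -> (forall s, f (tword s) = g (tword s)) -> f =1 g.
Proof.
by move=> fl gl fg; apply: tensor_powers_lin_ext => // s _; apply: fg.
Qed.

Section AlgebraLift.
Variables (B : algType k) (f : {linear V -> B}).

(* The algebra morphism extending f. *)
Definition alg_lift (x : Tbar) : B :=
  word_lift (fun s => \prod_(v <- s) f v) x.

Lemma prod_multi c s x y t :
  \prod_(v <- s ++ (c *: x + y) :: t) f v =
  c *: \prod_(v <- s ++ x :: t) f v + \prod_(v <- s ++ y :: t) f v.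
Proof.
rewrite !big_cat !big_cons /= linearP mulrDl mulrDr.
by rewrite -scalerAl -scalerAr.
Qed.

Lemma alg_lift_is_linear : linear alg_lift.
Proof. exact: (word_lift_is_linear prod_multi). Qed.
HB.instance Definition _ :=
  GRing.isLinear.Build k Tbar B *:%R alg_lift alg_lift_is_linear.

Lemma alg_lift_word s : alg_lift (tword s) = \prod_(v <- s) f v.
Proof. exact: (word_lift_word prod_multi). Qed.

Lemma alg_lift_is_monoid_morphism : monoid_morphism alg_lift.
Proof.
split=> [|x y]; first by rewrite -tword0 alg_lift_word big_nil.
elim/Tbar_ind: x => [|c s x IHx].
  by rewrite mul0r linear0 mul0r.
rewrite mulrDl -scalerAl !linearP /= IHx mulrDl -scalerAl; congr (_ *: _ + _) => {x IHx}.
elim/Tbar_ind: y => [|d t y IHy].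
  by rewrite mulr0 linear0 mulr0.
rewrite mulrDr -scalerAr !linearP /= IHy mulrDr -scalerAr; congr (_ *: _ + _).
by rewrite -tword_cat !alg_lift_word big_cat.
Qed.
HB.instance Definition _ := GRing.isMonoidMorphism.Build Tbar B alg_lift
  alg_lift_is_monoid_morphism.
End AlgebraLift.
End TensorAlgebra.

Section TensorPositive.
Variables (k : fieldType) (V : lmodType k).

Definition Tplus := tensor_powers 1 V.
HB.instance Definition _ := GRing.Lmodule.on Tplus.

Definition pword (s : seq V) : Tplus := word 1 s.

Lemma pword_multi c s x y t :
  pword (s ++ (c *: x + y) :: t) = c *: pword (s ++ x :: t) + pword (s ++ y :: t).
Proof. exact: wordDZ. Qed.

Lemma Tplus_ind (P : Tplus -> Prop) :
  P 0 -> (forall c s v, (0 < size s)%N -> P v -> P (c *: pword s + v)) ->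
  forall v, P v.
Proof. by move=> P0 PS; elim/tensor_powers_ind=> // c s v; apply: PS. Qed.

Lemma Tplus_lin_ext (W : lmodType k) (f g : Tplus -> W) :
  linear f -> linear g ->
  (forall s, (0 < size s)%N -> f (pword s) = g (pword s)) -> f =1 g.
Proof. by move=> fl gl fg; apply: tensor_powers_lin_ext. Qed.

Definition Tplus_incl (x : Tplus) : Tbar V := word_lift (@tword k V) x.

Lemma Tplus_incl_is_linear : linear Tplus_incl.
Proof. exact: (word_lift_is_linear (@tword_multi k V)). Qed.
HB.instance Definition _ :=
  GRing.isLinear.Build k Tplus (Tbar V) *:%R Tplus_incl Tplus_incl_is_linear.

Lemma Tplus_incl_word s : (0 < size s)%N -> Tplus_incl (pword s) = tword s.
Proof. exact: (word_lift_word (@tword_multi k V)). Qed.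
End TensorPositive.

(* (x ⊗ y) (x' ⊗ y') = (x * x') ⊗ (y * y') *)
HB.lock Definition tmul (k : fieldType) (B1 B2 : algType k)
    (t u : tensor B1 B2) : tensor B1 B2 :=
  tensor_lift (fun x y =>
    tensor_lift (fun x' y' => (x * x') ⊗ (y * y')) u) t.

Section TensorOfAlgebras.
Variables (k : fieldType) (B1 B2 : algType k).
Local Notation tmul := (@tmul k B1 B2).
Local Notation BB := (tensor B1 B2).

Lemma pure_linl (y : B2) : linear (fun x : B1 => x ⊗ y).
Proof. by move=> c x x'; rewrite pureDZl. Qed.
Lemma pure_linr (x : B1) : linear (fun y : B2 => x ⊗ y).
Proof. by move=> c y y'; rewrite pureDZr. Qed.

Lemma tmul_inner x y :
  (forall y', linear (fun x' : B1 => (x * x') ⊗ (y * y'))) /\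
  (forall x', linear (fun y' : B2 => (x * x') ⊗ (y * y'))).
Proof.
by split=> ? c ? ?; rewrite mulrDr -scalerAr (pureDZl, pureDZr).
Qed.

Lemma tmul_inner_lin x y :
  linear (tensor_lift (fun x' y' => (x * x') ⊗ (y * y')) : BB -> BB).
Proof. by apply: tensor_lift_is_linear; case: (tmul_inner x y). Qed.

Lemma tmul_inner_pure x y (x1 : B1) (y1 : B2) :
  tensor_lift (fun x' y' => (x * x') ⊗ (y * y') : BB) (x1 ⊗ y1) =
  (x * x1) ⊗ (y * y1).
Proof. by apply: tensor_lift_pure; case: (tmul_inner x y). Qed.

Lemma lin_comb (f g : BB -> BB) c : linear f -> linear g ->
  linear (fun u => c *: f u + g u).
Proof.
by move=> fl gl d u v; rewrite fl gl; exact: comb_swap.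
Qed.

Lemma tmul_outer u :
  (forall y, linear (fun x =>
     tensor_lift (fun x' y' => (x * x') ⊗ (y * y')) u : BB)) /\
  (forall x, linear (fun y =>
     tensor_lift (fun x' y' => (x * x') ⊗ (y * y')) u : BB)).
Proof.
split=> [y c x1 x2|x c y1 y2].
  apply: (tensor_lin_ext _ (lin_comb c (tmul_inner_lin x1 y)
    (tmul_inner_lin x2 y))) => [|x' y']; first exact: tmul_inner_lin.
  by rewrite !tmul_inner_pure mulrDl -scalerAl pureDZl.
apply: (tensor_lin_ext _ (lin_comb c (tmul_inner_lin x y1)
  (tmul_inner_lin x y2))) => [|x' y']; first exact: tmul_inner_lin.
by rewrite !tmul_inner_pure mulrDl -scalerAl pureDZr.
Qed.

Lemma tmul_linearl u : linear (tmul^~ u).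
Proof.
by rewrite tmul.unlock; apply: tensor_lift_is_linear; case: (tmul_outer u).
Qed.

Lemma tmul_pure x y x' y' :
  tmul (x ⊗ y) (x' ⊗ y') = (x * x') ⊗ (y * y').
Proof.
rewrite tmul.unlock tensor_lift_pure ?tmul_inner_pure //.
  by case: (tmul_outer (x' ⊗ y')).
by case: (tmul_outer (x' ⊗ y')).
Qed.

Lemma tmul_linearr u : linear (tmul u).
Proof.
move=> c v w; elim/tensor_ind: u => [|d x y u IH].
  by rewrite !(lin0 (tmul_linearl _)) scaler0 addr0.
have E z : tmul (x ⊗ y) z =
    tensor_lift (fun x' y' => (x * x') ⊗ (y * y') : BB) z.
  by rewrite tmul.unlock; apply: tensor_lift_pure; case: (tmul_outer z).
rewrite (@tmul_linearl (c *: v + w) d) (@tmul_linearl v d) (@tmul_linearl w d).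
rewrite (E v) (E w) (E (c *: v + w)) (tmul_inner_lin x y) IH.
exact: comb_swap.
Qed.

Lemma tmulA : associative tmul.
Proof.
move=> x y z; elim/tensor_ind: x => [|c x1 x2 x IHx].
  by rewrite !(lin0 (tmul_linearl _)).
rewrite !(@tmul_linearl _ c) IHx; congr (_ *: _ + _) => {x IHx}.
elim/tensor_ind: y => [|d y1 y2 y IHy].
  by rewrite (lin0 (tmul_linearl _)) !(lin0 (tmul_linearr _))
    (lin0 (tmul_linearl _)).
rewrite (@tmul_linearl z d) (@tmul_linearr (x1 ⊗ x2) d).
rewrite (@tmul_linearr (x1 ⊗ x2) d) (@tmul_linearl z d) IHy.
congr (_ *: _ + _) => {y IHy}.
elim/tensor_ind: z => [|e z1 z2 z IHz].
  by rewrite !(lin0 (tmul_linearr _)).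
rewrite (@tmul_linearr (y1 ⊗ y2) e) (@tmul_linearr (x1 ⊗ x2) e).
rewrite (@tmul_linearr (tmul (x1 ⊗ x2) (y1 ⊗ y2)) e) IHz.
by rewrite (tmul_pure y1) (tmul_pure x1) (tmul_pure x1) (tmul_pure (x1 * y1)) !mulrA.
Qed.

Lemma tmul1l : left_id (1 ⊗ 1) tmul.
Proof.
elim/tensor_ind=> [|c x y u IH]; first by rewrite !(lin0 (tmul_linearr _)).
by rewrite (@tmul_linearr _ c) IH tmul_pure !mul1r.
Qed.

Lemma tmul1r : right_id (1 ⊗ 1) tmul.
Proof.
elim/tensor_ind=> [|c x y u IH]; first by rewrite !(lin0 (tmul_linearl _)).
by rewrite (@tmul_linearl _ c) IH tmul_pure !mulr1.
Qed.

Lemma tmulDl : left_distributive tmul +%R.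
Proof. by move=> x y z; have := @tmul_linearl z 1 x y; rewrite !scale1r. Qed.

Lemma tmulDr : right_distributive tmul +%R.
Proof. by move=> z x y; have := @tmul_linearr z 1 x y; rewrite !scale1r. Qed.

Lemma tmulZl c x y : c *: tmul x y = tmul (c *: x) y.
Proof. by symmetry; exact: (linZ c x (@tmul_linearl y)). Qed.

Lemma tmulZr c x y : c *: tmul x y = tmul x (c *: y).
Proof. by symmetry; exact: (linZ c y (@tmul_linearr x)). Qed.
End TensorOfAlgebras.

Section TensorOfTensorAlgebras.
Variables (k : fieldType) (V W : lmodType k).
Local Notation TT := (tensor (Tbar V) (Tbar W)).

Lemma tmul1_neq0 : (1 ⊗ 1 : TT) != 0.
Proof.
pose f := alg_lift (\0 : V -> k^o); pose g := alg_lift (\0 : W -> k^o).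
apply/eqP => E0; have := tensor_form_pure f g 1 1.
rewrite E0 linear0 !rmorph1 mulr1.
by move/esym/eqP; rewrite oner_eq0.
Qed.

HB.instance Definition _ := GRing.Zmodule_isNzRing.Build TT
  (@tmulA k _ _) (@tmul1l k _ _) (@tmul1r k _ _) (@tmulDl k _ _) (@tmulDr k _ _)
  tmul1_neq0.
HB.instance Definition _ :=
  GRing.Lmodule_isLalgebra.Build k TT (@tmulZl k _ _).
HB.instance Definition _ := GRing.Lalgebra_isAlgebra.Build k TT (@tmulZr k _ _).

Lemma mul_pure (x x' : Tbar V) (y y' : Tbar W) :
  (x ⊗ y : TT) * (x' ⊗ y') = (x * x') ⊗ (y * y').
Proof. exact: tmul_pure. Qed.
End TensorOfTensorAlgebras.

Section Subwords.
Variables (T : Type) (n : nat).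

Definition subword (a : n.-tuple T) (S : {set 'I_n}) : #|S|.-tuple T :=
  [tuple of [seq tnth a i | i in S]].

Definition left_end (J : {set 'I_n}) (i : 'I_n) : bool :=
  (i \in J) && [forall j : 'I_n, (j.+1 == i) ==> (j \notin J)].

(* If i is in J, the part at the right of i of the maximal interval of J
   containing i; the connected components of J are obtained at its left ends. *)
Definition component (J : {set 'I_n}) (i : 'I_n) : {set 'I_n} :=
  [set j : 'I_n | (i <= j)%N &&
    [forall l : 'I_n, ((i <= l) && (l <= j))%N ==> (l \in J)]].
End Subwords.


Notation double_tensor A := (Tbar (Tplus A)).

Section DoubleTensorAlgebra.
Variables (k : fieldType) (A : algType k).
Local Notation H := (double_tensor A).

(* The word s, seen in H; the empty word is identified with the unit. *)
Definition letters (s : seq A) : H :=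
  if s is [::] then 1 else tword [:: pword s].

Lemma letters_multi c s x y t : letters (s ++ (c *: x + y) :: t) =
  c *: letters (s ++ x :: t) + letters (s ++ y :: t).
Proof.
have E z : letters (s ++ z :: t) = tword [:: pword (s ++ z :: t)] by case: s.
rewrite !E pword_multi.
exact: (tword_multi c [::] (pword (s ++ x :: t)) (pword (s ++ y :: t)) [::]).
Qed.

(* a_S *)
Definition keep n (a : n.-tuple A) (S : {set 'I_n}) : H :=
  letters (subword a S).

(* a_{J_1} | ... | a_{J_l}, with J_1, ..., J_l the connected components of the
   complement of S: they are indexed by their left ends, and the product over
   'I_n is taken in increasing order. *)
Definition remove n (a : n.-tuple A) (S : {set 'I_n}) : H :=
  \prod_(i < n | left_end (~: S) i) letters (subword a (component (~: S) i)).

Definition coproduct_tuple n (a : n.-tuple A) : tensor H H :=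
  \sum_(S : {set 'I_n}) keep a S ⊗ remove a S.

Definition coproduct_word (s : seq A) : tensor H H :=
  coproduct_tuple (in_tuple s).

Lemma coproduct_wordE n (a : n.-tuple A) : coproduct_word a = coproduct_tuple a.
Proof.
case: a => s /= sn; case: _ / {1 2}(eqP sn) (sn) => sn' /=.
by rewrite /coproduct_word; congr coproduct_tuple; apply: val_inj.
Qed.

Section Multilinearity.
Variables (n : nat) (p : 'I_n) (c : k) (x y : A) (u v w : n.-tuple A).
Hypotheses (up : tnth u p = c *: x + y) (vp : tnth v p = x) (wp : tnth w p = y).
Hypothesis off : forall i, i != p ->
  tnth u i = tnth w i /\ tnth v i = tnth w i.

Lemma subword_off (S : {set 'I_n}) : p \notin S ->
  subword u S = subword w S :> seq A /\ subword v S = subword w S :> seq A.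
Proof.
move=> pS; split; apply/eq_in_map => i; rewrite mem_enum => iS; apply: (off _).1 || apply: (off _).2;
by apply: contraNneq pS => <-.
Qed.

Lemma letters_off (S : {set 'I_n}) : p \notin S ->
  letters (subword u S) = letters (subword w S) /\
  letters (subword v S) = letters (subword w S).
Proof. by move=> /subword_off [-> ->]. Qed.

Lemma letters_on (S : {set 'I_n}) : p \in S -> letters (subword u S) =
  c *: letters (subword v S) + letters (subword w S).
Proof.
move=> pS; have pe : p \in enum S by rewrite mem_enum.
have ue := enum_uniq (mem S).
rewrite /= /image_mem; case/splitPr: pe ue => e1 e2.
rewrite cat_uniq /= => /and3P[_ /norP[p1 _] /andP[p2 _]].
rewrite !map_cat /= up vp wp.
have E1 e : p \notin e ->
    map (tnth u) e = map (tnth w) e /\ map (tnth v) e = map (tnth w) e.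
  move=> pe; split; apply/eq_in_map => i ie;
    [apply: (off _).1 | apply: (off _).2]; by apply: contraNneq pe => <-.
have [-> ->] := E1 _ p1; have [-> ->] := E1 _ p2.
exact: letters_multi.
Qed.

Lemma component_sub (J : {set 'I_n}) i : component J i \subset J.
Proof.
apply/subsetP => j; rewrite inE => /andP[ij /forallP/(_ j)].
by rewrite ij leqnn.
Qed.

Lemma component_uniq (J : {set 'I_n}) i i' : left_end J i -> left_end J i' ->
  p \in component J i -> p \in component J i' -> i = i'.
Proof.
wlog ii : i i' / (i < i')%N => [hw le_i le_i' pi pi'|].
  apply: val_inj => /=; case: (ltngtP i i') => // ii; first exact: congr1 (hw _ _ ii _ _ _ _).
  by apply/esym/(congr1 val)/hw.
move=> _ /andP[_ /forallP le_i'].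
rewrite !inE => /andP[ip /forallP iJ] /andP[i'p _].
have lt : (i'.-1 < n)%N by apply: leq_ltn_trans (leq_pred _) (ltn_ord i').
have i'0 : (0 < i')%N by apply: leq_ltn_trans ii.
have := le_i' (Ordinal lt); rewrite /= prednK // eqxx /=.
have := iJ (Ordinal lt); rewrite /= -ltnS prednK // ii /= => /implyP ->//.
by apply: leq_trans i'p; apply: leq_pred.
Qed.

Lemma component_ex (J : {set 'I_n}) : p \in J ->
  exists2 i, left_end J i & p \in component J i.
Proof.
move=> pJ; pose Q (i : 'I_n) := p \in component J i.
have Qp : Q p.
  rewrite /Q inE leqnn /=; apply/forallP => l; apply/implyP => pl.
  by rewrite -(val_inj (anti_leq pl) : p = l).
case: (arg_minnP (fun i : 'I_n => i : nat) Qp) => i Qi imin.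
exists i => //; move: Qi; rewrite /Q inE => /andP[ip /forallP iJ].
apply/andP; split; first by have := iJ i; rewrite leqnn ip.
apply/forallP => j; apply/implyP => /eqP ji; apply/negP => jJ.
have : Q j.
  rewrite /Q inE; apply/andP; split; first by apply: leq_trans ip; rewrite -ji.
  apply/forallP => l; apply/implyP => /andP[jl lp].
  have [->//|neq] := eqVneq l j.
  have := iJ l; rewrite lp andbT -ji ltn_neqAle jl andbT.
  by rewrite (_ : val j != val l) //; apply: contra neq => /eqP/val_inj ->.
by move=> /imin; rewrite leqNgt -ji ltnS leqnn.
Qed.

Lemma remove_off (S : {set 'I_n}) : p \in S -> remove u S = remove w S /\ remove v S = remove w S.
Proof.
move=> pS; have pc i : p \notin component (~: S) i.
  apply: contraL pS => /(subsetP (component_sub _ _)).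
  by rewrite inE.
by split; apply: eq_bigr => i _; have [] := letters_off (pc i).
Qed.

Lemma remove_on (S : {set 'I_n}) : p \notin S -> remove u S = c *: remove v S + remove w S.
Proof.
move=> pS; have /component_ex [i lei pi] : p \in ~: S by rewrite inE.
have ir := mem_index_enum i; have ur := index_enum_uniq 'I_n.
rewrite /remove; case/splitPr: ir ur => r1 r2.
rewrite cat_uniq /= => /and3P[_ /norP[i1 _] /andP[i2 _]].
have E r : i \notin r ->
    (\prod_(j <- r | left_end (~: S) j) letters (subword u (component (~: S) j)) =
     \prod_(j <- r | left_end (~: S) j) letters (subword w (component (~: S) j)))
    /\
    (\prod_(j <- r | left_end (~: S) j) letters (subword v (component (~: S) j)) =
     \prod_(j <- r | left_end (~: S) j) letters (subword w (component (~: S) j))).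
  move=> ir; have F j : j \in r -> left_end (~: S) j -> p \notin component (~: S) j.
    move=> jr lej; apply: contra ir => pj.
    by rewrite (component_uniq lei lej pi pj).
  split; rewrite big_seq_cond [RHS]big_seq_cond; apply: eq_bigr => j /andP[jr lej];
    by have [] := letters_off (F j jr lej).
rewrite !big_cat !big_cons /= lei.
have [-> ->] := E _ i1; have [-> ->] := E _ i2.
by rewrite letters_on // mulrDl mulrDr -scalerAl -scalerAr.
Qed.

Lemma coproduct_tuple_multi :
  coproduct_tuple u = c *: coproduct_tuple v + coproduct_tuple w.
Proof.
rewrite /coproduct_tuple scaler_sumr -big_split /=; apply: eq_bigr => S _.
have [pS|pS] := boolP (p \in S).
  have [-> ->] := remove_off pS.
  by rewrite /keep letters_on // pureDZl.
rewrite /keep; have [-> ->] := letters_off pS.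
by rewrite remove_on // pureDZr.
Qed.
End Multilinearity.

Lemma coproduct_word_multi c s x y t :
  coproduct_word (s ++ (c *: x + y) :: t) =
  c *: coproduct_word (s ++ x :: t) + coproduct_word (s ++ y :: t).
Proof.
pose T z := [tuple of in_tuple s ++ z :: in_tuple t].
have lt : (size s < size s + (size t).+1)%N by rewrite addnS ltnS leq_addr.
have E z : coproduct_word (s ++ z :: t) = coproduct_tuple (T z).
  exact: (coproduct_wordE (T z)).
have P z : tnth (T z) (Ordinal lt) = z.
  by rewrite (tnth_nth z) /= nth_cat ltnn subnn.
rewrite !E; apply: (coproduct_tuple_multi (P _) (P _) (P _)) => i ip.
have F z z' : tnth (T z) i = tnth (T z') i.
  rewrite !(tnth_nth 0) /= !nth_cat; case: ifP => // is_.
  case Di: (i - size s)%N => [|m] //=.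
  case/negP: ip; apply/eqP/val_inj => /=; apply/eqP.
  by rewrite eqn_leq -subn_eq0 Di eqxx leqNgt is_.
by split; apply: F.
Qed.

Definition coproductT (x : Tplus A) : tensor H H := word_lift coproduct_word x.

Lemma coproductT_is_linear : linear coproductT.
Proof. exact: (word_lift_is_linear coproduct_word_multi). Qed.
HB.instance Definition _ := GRing.isLinear.Build k (Tplus A) (tensor H H) *:%R
  coproductT coproductT_is_linear.

Lemma coproductT_word n (a : n.-tuple A) : (0 < n)%N ->
  coproductT (pword a) = coproduct_tuple a.
Proof.
move=> n0; rewrite -coproduct_wordE.
by apply: (word_lift_word coproduct_word_multi); rewrite size_tuple.
Qed.

(* The algebra morphism extending coproductT. *)
Definition coproduct : H -> tensor H H := alg_lift coproductT.
HB.instance Definition _ := GRing.LRMorphism.on coproduct.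

Lemma coproduct_letters n (a : n.-tuple A) : (0 < n)%N ->
  coproduct (letters a) = \sum_(S : {set 'I_n}) keep a S ⊗ remove a S.
Proof.
move=> n0; rewrite -/(coproduct_tuple a) -coproductT_word //.
have -> : letters a = tword [:: pword a].
  by case: a => -[|x s] //= /eqP sn; rewrite -sn in n0.
by rewrite /coproduct alg_lift_word big_seq1.
Qed.

(* The counit: 1 on the unit, 0 on nonempty bar words. *)
Definition counit : H -> k^o := alg_lift (\0 : Tplus A -> k^o).
HB.instance Definition _ := GRing.LRMorphism.on counit.

Definition conv (f g : {linear H -> k^o}) : H -> k^o :=
  tensor_form f g \o coproduct.
HB.instance Definition _ f g := GRing.Linear.on (conv f g).

Fixpoint conv_pow (f : {linear H -> k^o}) (j : nat) : {linear H -> k^o} :=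
  if j is j'.+1 then conv f (conv_pow f j') else counit.

(* The sum is the library's sum over a set, which is the usual one for families
   of finite support, and 0 otherwise. *)
Definition exp_star (f : {linear H -> k^o}) (x : H) : k :=
  \sum_(j \in [set: nat]%classic) (j`!%:R^-1 * conv_pow f j x).

Definition infinitesimal_character (f : {linear H -> k^o}) : Prop :=
  f 1 = 0 /\
  forall x y : Tplus (Tplus A), f (Tplus_incl x * Tplus_incl y) = 0.

Section ExtendedForm.
Variable phi : {linear A -> k^o}.

Definition phi_word (s : seq A) : k^o := phi (\prod_(a <- s) a).

Lemma phi_word_multi c s x y t : phi_word (s ++ (c *: x + y) :: t) =
  c *: phi_word (s ++ x :: t) + phi_word (s ++ y :: t).
Proof.
rewrite /phi_word !big_cat !big_cons /= mulrDl mulrDr -scalerAl -scalerAr.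
exact: linearP.
Qed.

Definition phiT (x : Tplus A) : k^o := word_lift phi_word x.

Lemma phiT_is_linear : linear phiT.
Proof. exact: (word_lift_is_linear phi_word_multi). Qed.
HB.instance Definition _ :=
  GRing.isLinear.Build k (Tplus A) k^o *:%R phiT phiT_is_linear.

(* Characters are the algebra morphisms from H to k; this is the one which
   extends phi. *)
Definition Phi : H -> k^o := alg_lift phiT.
HB.instance Definition _ := GRing.LRMorphism.on Phi.

Lemma Phi_letters s : (0 < size s)%N -> Phi (letters s) = phi (\prod_(a <- s) a).
Proof.
case: s => // a s _; rewrite /Phi alg_lift_word big_seq1.
exact: (word_lift_word phi_word_multi).
Qed.
End ExtendedForm.
End DoubleTensorAlgebra.

Section MonotonePartitions.
Variable n : nat.
Implicit Types (B C : {set 'I_n}) (P : {set {set 'I_n}}).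

Definition noncrossing P : bool :=
  partition P [set: 'I_n] &&
  [forall B in P, forall C in P, (B != C) ==>
    [forall i in B, forall l in B, forall j in C, forall m in C,
      ~~ ((i < j) && (j < l) && (l < m))%N]].

(* B <= C, i.e. C is nested in B *)
Definition block_le B C : bool :=
  [exists a in B, exists b in B, exists c in C, ((a <= c) && (c <= b))%N].

(* r is (the graph of) a total order on the blocks of P refining block_le *)
Definition monotone_labelling P (r : {set {set 'I_n} * {set 'I_n}}) : bool :=
  [&& r \subset setX P P,
      [forall B in P, (B, B) \in r],
      [forall B in P, forall C in P, ((B, C) \in r) && ((C, B) \in r) ==> (B == C)],
      [forall B in P, forall C in P, forall D in P,
        ((B, C) \in r) && ((C, D) \in r) ==> ((B, D) \in r)],
      [forall B in P, forall C in P, ((B, C) \in r) || ((C, B) \in r)]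
    & [forall B in P, forall C in P, block_le B C ==> ((B, C) \in r)]].

Definition nb_labellings P : nat := #|[set r | monotone_labelling P r]|.

Definition monotone_partition
    (g : {set {set 'I_n}} * {set {set 'I_n} * {set 'I_n}}) : bool :=
  noncrossing g.1 && monotone_labelling g.1 g.2.
End MonotonePartitions.

Section MonotoneCumulants.
Variables (k : fieldType) (A : algType k).

Definition form_family := forall n, n.-tuple A -> k.

Definition set_letter n (a : n.-tuple A) (i : 'I_n) (x : A) : n.-tuple A :=
  [tuple if j == i then x else tnth a j | j < n].

Definition multilinear_family (h : form_family) : Prop :=
  forall n (a : n.-tuple A) (i : 'I_n) (c : k) (x y : A),
    h n (set_letter a i (c *: x + y)) =
    c * h n (set_letter a i x) + h n (set_letter a i y).

(* h_gamma(a_1, ..., a_n) *)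
Definition block_product (h : form_family) n (P : {set {set 'I_n}})
    (a : n.-tuple A) : k :=
  \prod_(B in P) h #|B| (subword a B).

(* h_0 plays no role: blocks are nonempty. *)
Definition monotone_cumulants (phi : A -> k) (h : form_family) : Prop :=
  multilinear_family h /\
  forall n (a : n.-tuple A), (0 < n)%N ->
    phi (\prod_(i < n) tnth a i) =
    \sum_(g | @monotone_partition n g)
      (#|g.1|)`!%:R^-1 * block_product h g.1 a.
End MonotoneCumulants.

(* Main.v *)
From HB Require Import structures.
Require Import Defs.
From mathcomp Require Import classical_sets fsbigop.
From mathcomp Require Import all_boot all_order all_algebra.

Set Implicit Arguments.
Unset Strict Implicit.
Unset Printing Implicit Defensive.

Import GRing.Theory.
Local Open Scope ring_scope.

(** Left convolution by an infinitesimal character is dual to a derivation.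
    Since rho vanishes on 1 and on products of bar words, it is a derivation
    along the counit, so that D := (rho ⊗ id) \o Delta is a derivation of the
    double tensor algebra ([peelM]), and rho^{*j} = counit \o D^j.

    For a set U of positions, let bar U be the bar word whose factors are the
    connected components of U.  By the Leibniz rule, and by the formula for
    Delta on one word, D (bar U) is the sum, over the nonempty S contained in a
    single component of U, of rho(a_S) bar(U \ S) ([peel_bar]).  That S lies in
    one component of U says exactly that no position already removed lies
    between two elements of S.  Iterating from U = [n], the number
    rho^{*j}(a_1...a_n) is the sum of the products rho(a_{S_1})...rho(a_{S_j})
    over the sequences of nonempty sets which exhaust [n] and in which no
    element of an earlier set is enclosed by a later one ([conv_pow_bar],
    [peelingE]).

    These sequences are the monotone partitions.  Two crossing blocks each
    enclose an element of the other, whence neither could come first; and for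
    non-crossing blocks the condition says that a block comes before those
    nested in it, i.e. that the sequence lists the blocks along a linear
    extension of the nesting order ([monotone_seq_noncrossing],
    [nb_labellingsE]).  Hence the first formula, the factor 1/j! being that of
    the exponential; grouping the pairs (partition, labelling) gives the
    moment-cumulant relation.

    Uniqueness ([monotone_cumulants_unique]): in the relation for n letters, the
    one-block partition contributes h_n with coefficient 1, and every other
    partition has all its blocks of size smaller than n. *)

(** * Contraction of the left tensor factor *)

Section Contraction.
Variables (k : fieldType) (V : lmodType k) (f : {linear Tbar V -> k^o}).
Local Notation H := (Tbar V).

Definition contract (t : tensor H H) : H := tensor_lift (fun x y => (f x : k) *: y) t.

Lemma contract_bilinear :
  (forall y : H, linear (fun x => (f x : k) *: y)) /\
  (forall x, linear (fun y : H => (f x : k) *: y)).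
Proof.
split=> [y c x x'|x c y y']; first by rewrite linearP scalerDl scalerA.
by rewrite scalerDr !scalerA mulrC.
Qed.

Lemma contract_is_linear : linear contract.
Proof. by apply: tensor_lift_is_linear; case: contract_bilinear. Qed.
HB.instance Definition _ :=
  GRing.isLinear.Build k (tensor H H) H *:%R contract contract_is_linear.

Lemma contract_pure x y : contract (x ⊗ y) = (f x : k) *: y.
Proof. by apply: tensor_lift_pure; case: contract_bilinear. Qed.

Lemma tensor_form_contract (g : {linear H -> k^o}) t :
  tensor_form f g t = g (contract t).
Proof.
apply: (tensor_lin_ext (f := tensor_form f g) (g := g \o contract)).
- exact: linearP.
- exact: linearP.
- by move=> x y; rewrite /= tensor_form_pure contract_pure linearZ.
Qed.
End Contraction.

Section ContractMul.
Variables (k : fieldType) (V : lmodType k).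
Local Notation H := (Tbar V).

Lemma tensor_ind2 (P : tensor H H -> tensor H H -> Prop) :
  (forall u, P 0 u) -> (forall u, P u 0) ->
  (forall c x y u v, P (x ⊗ y) v -> P u v -> P (c *: (x ⊗ y) + u) v) ->
  (forall c x y u v, P u (x ⊗ y) -> P u v -> P u (c *: (x ⊗ y) + v)) ->
  (forall x y x' y', P (x ⊗ y) (x' ⊗ y')) -> forall u v, P u v.
Proof.
move=> P0l P0r Pl Pr Pp u v; elim/tensor_ind: u => [//|c x y u IHu].
apply: Pl => // {IHu u c}; elim/tensor_ind: v => [//|c x' y' v IHv].
exact: Pr.
Qed.

(** To be used with e the counit, for which (e ⊗ id) \o Delta is the identity:
    this skew Leibniz rule then becomes the ordinary one for (d ⊗ id) \o Delta. *)
Lemma contract_mul (d e : {linear H -> k^o}) :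
  {morph e : x y / x * y} ->
  (forall x y, d (x * y) = d x * e y + e x * d y) ->
  forall t u : tensor H H,
  contract d (t * u) = contract d t * contract e u + contract e t * contract d u.
Proof.
move=> eM dM t u.
elim/tensor_ind2: t / u => [u|u|c x y t u IH1 IH2|c x y u t IH1 IH2|x y x' y'].
- by rewrite mul0r !linear0 !mul0r addr0.
- by rewrite mulr0 !linear0 !mulr0 addr0.
- rewrite mulrDl -scalerAl !linearP /= IH1 IH2 !mulrDl -!scalerAl scalerDr.
  by rewrite addrACA.
- rewrite mulrDr -scalerAr !linearP /= IH1 IH2 !mulrDr -!scalerAr scalerDr.
  by rewrite addrACA.
rewrite mul_pure !contract_pure dM scalerDl -!scalerAl -!scalerAr !scalerA.
by [].
Qed.
End ContractMul.

(** * The derivation dual to convolution by an infinitesimal character *)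

Section Peel.
Variables (k : fieldType) (A : algType k).
Local Notation H := (double_tensor A).

Lemma left_end_setT n (i : 'I_n) : left_end [set: 'I_n] i = (i == 0 :> nat).
Proof.
rewrite /left_end in_setT /=; apply/forallP/eqP => [hi|-> j]; last first.
  by apply/implyP => /eqP.
case Di: (nat_of_ord i) => [//|m].
have lt : (m < n)%N by rewrite (leq_trans _ (ltn_ord i)) // Di.
by have := hi (Ordinal lt); rewrite /= Di eqxx in_setT.
Qed.

Lemma subword_setT n (a : n.-tuple A) : subword a setT = a :> seq A.
Proof.
rewrite /= /image_mem (eq_enum (B := predT)); last by move=> i; rewrite inE.
by rewrite -[RHS](@map_tnth_enum _ _ a) enumT.
Qed.

Lemma remove_set0 n (a : n.-tuple A) : (0 < n)%N -> remove a set0 = letters a.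
Proof.
case: n a => // n a _; rewrite /remove setC0.
rewrite (eq_bigl (pred1 ord0)); last exact: left_end_setT.
rewrite big_pred1_eq -[in RHS](subword_setT a); congr (letters (subword a _)).
apply/setP => i; rewrite !inE /=.
by apply/forallP => j; rewrite inE implybT.
Qed.

Lemma size_subword n (a : n.-tuple A) (S : {set 'I_n}) :
  (0 < size (subword a S))%N = (S != set0).
Proof. by rewrite size_tuple card_gt0. Qed.

Lemma keep_set0 n (a : n.-tuple A) : keep a set0 = 1 :> H.
Proof. by rewrite /keep /= /image_mem enum_set0. Qed.

Lemma counit_letters s : (0 < size s)%N -> counit (letters s : H) = 0.
Proof. by case: s => // x s _; rewrite /counit alg_lift_word big_seq1. Qed.

Lemma letters_tword s : (0 < size s)%N -> letters s = tword [:: pword s] :> H.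
Proof. by case: s. Qed.

Lemma tword_cons (V : lmodType k) (v : V) s : tword (v :: s) = tword [:: v] * tword s.
Proof. by rewrite -tword_cat. Qed.

(** The left counit axiom.  Both sides are algebra morphisms, so it is enough to
    compare them on words, where only the term S = set0 of the coproduct
    survives. *)
Lemma contract_counit (x : H) : contract (@counit k A) (coproduct x) = x.
Proof.
pose E (y : H) := contract (@counit k A) (coproduct y); rewrite -/(E x).
have EM : {morph E : x y / x * y}.
  move=> {}x y; rewrite /E rmorphM /=.
  elim/tensor_ind2: (coproduct x) / (coproduct y) =>
    [u|u|c x1 y1 t u IH1 IH2|c x1 y1 t u IH1 IH2|x1 y1 x2 y2].
  - by rewrite mul0r !linear0 !mul0r.
  - by rewrite mulr0 !linear0 !mulr0.
  - by rewrite mulrDl -scalerAl !linearP /= IH1 IH2 mulrDl -scalerAl.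
  - by rewrite mulrDr -scalerAr !linearP /= IH1 IH2 mulrDr -scalerAr.
  by rewrite mul_pure !contract_pure rmorphM /= -scalerAl -scalerAr scalerA.
have E1 : E 1 = 1.
  by rewrite /E rmorph1 contract_pure rmorph1 scale1r.
have El : linear E by move=> c u v; rewrite /E !linearP.
apply: (Tbar_lin_ext (f := E) (g := id)) => // {x}.
elim=> [//|v s IH]; rewrite tword_cons EM IH; congr (_ * _) => {s IH}.
elim/Tplus_ind: v => [|c s v s0 IH].
  have ->: tword [:: 0] = 0 :> H.
    have := @tword_multi _ (Tplus A) (-1) [::] 0 0 [::].
    by rewrite scaler0 addr0 scaleN1r addNr.
  by rewrite (lin0 El).
rewrite (@tword_multi _ _ c [::] (pword s) v [::]) El IH.
congr (_ *: _ + _); rewrite -letters_tword //.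
rewrite /E -[s]/(tval (in_tuple s)) coproduct_letters // linear_sum (bigD1 set0) //=.
rewrite keep_set0 contract_pure rmorph1 scale1r remove_set0 // big1 ?addr0 //.
move=> S S0; rewrite contract_pure /= counit_letters ?scale0r //.
by rewrite size_subword.
Qed.

Variable rho : {linear H -> k^o}.
Hypothesis rho_inf : infinitesimal_character rho.

(** By bilinearity x and y may be bar words; if both are nonempty then
    both sides vanish, and otherwise one of the words is 1. *)
Lemma infinitesimal_derivation (x y : H) :
  rho (x * y) = rho x * counit y + counit x * rho y.
Proof.
case: rho_inf => r1 rM.
elim/Tbar_ind: x => [|c s x IHx].
  by rewrite mul0r !linear0 !mul0r addr0.
rewrite mulrDl -scalerAl !linearP /= IHx !mulrDl addrACA; congr (_ + _).
rewrite /GRing.scale /= -!mulrA -mulrDr; congr (_ * _).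
elim/Tbar_ind: y {IHx} => [|d t y IHy].
  by rewrite mulr0 !linear0 !mulr0 addr0.
rewrite mulrDr -scalerAr !linearP /= IHy !mulrDr addrACA; congr (_ + _).
rewrite /GRing.scale /= !(mulrCA _ d) -mulrDr; congr (_ * _) => {IHy}.
case: s => [|b0 s]; first by rewrite tword0 mul1r r1 rmorph1 mul0r add0r mul1r.
case: t => [|b t]; first by rewrite tword0 mulr1 r1 rmorph1 mulr1 mulr0 addr0.
rewrite -[tword (b0 :: s)](Tplus_incl_word (s := b0 :: s)) //.
rewrite -[tword (b :: t)](Tplus_incl_word (s := b :: t)) // rM.
rewrite !Tplus_incl_word // tword_cons (tword_cons b) !rmorphM /=.
have E0 v : counit (tword [:: v] : H) = 0.
  by rewrite /counit alg_lift_word big_seq1.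
by rewrite !E0 !mul0r mulr0 addr0.
Qed.

(** The derivation (rho ⊗ id) \o Delta.  It takes off one block, with weight
    rho, from one factor of a bar word; the block is the lowest one for the
    monotone labelling that iteration produces. *)
Definition peel (x : H) : H := contract rho (coproduct x).

Lemma peel_is_linear : linear peel.
Proof. by move=> c u v; rewrite /peel !linearP. Qed.
HB.instance Definition _ :=
  GRing.isLinear.Build k H H *:%R peel peel_is_linear.

Lemma peelM (x y : H) : peel (x * y) = peel x * y + x * peel y.
Proof.
rewrite /peel rmorphM (contract_mul (e := @counit k A)) ?contract_counit //.
  exact: rmorphM.
exact: infinitesimal_derivation.
Qed.

Lemma conv_powS j x : conv_pow rho j.+1 x = conv_pow rho j (peel x).
Proof. exact: (tensor_form_contract rho (conv_pow rho j)). Qed.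

Lemma peel_letters n (a : n.-tuple A) : (0 < n)%N ->
  peel (letters a) =
  \sum_(S : {set 'I_n} | S != set0) (rho (letters (subword a S)) : k) *: remove a S.
Proof.
move=> n0; rewrite /peel coproduct_letters // linear_sum (bigD1 set0) //=.
rewrite keep_set0 contract_pure (proj1 rho_inf) scale0r add0r.
by apply: eq_bigr => S _; rewrite contract_pure.
Qed.
End Peel.

(** * Bar words indexed by sets of positions *)

Section Intervals.
Variable n : nat.
Implicit Types (U S T : {set 'I_n}) (i j l p : 'I_n).

Lemma componentP U i j :
  reflect ((i <= j)%N /\ forall l, (i <= l <= j)%N -> l \in U)
          (j \in component U i).
Proof.
rewrite inE; apply: (iffP andP) => -[ij hU]; split=> //.
  by move=> l il; have /forallP/(_ l) := hU; rewrite il.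
by apply/forallP => l; apply/implyP; apply: hU.
Qed.

Lemma left_endP U i :
  reflect (i \in U /\ forall j, j.+1 = i -> j \notin U) (left_end U i).
Proof.
apply: (iffP andP) => -[iU hU]; split=> //.
  by move=> j /eqP ji; have /forallP/(_ j) := hU; rewrite ji.
by apply/forallP => j; apply/implyP => /eqP; apply: hU.
Qed.

Lemma left_end_ltn U p i : p \notin U ->
  left_end [set l in U | (l < p)%N] i = left_end U i && (i < p)%N.
Proof.
move=> pU; apply/left_endP/andP; rewrite inE.
  case=> /andP[iU ip] hi; split=> //; apply/left_endP; split=> // j ji.
  by have := hi j ji; rewrite inE (leq_trans _ ip) ?andbT // -ji.
case=> /left_endP[iU hi] ip; rewrite iU ip; split=> // j /hi jU.
by rewrite inE (negbTE jU).
Qed.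

Lemma left_end_gtn U p i : p \notin U ->
  left_end [set l in U | (p < l)%N] i = left_end U i && (p < i)%N.
Proof.
move=> pU; apply/left_endP/andP; rewrite inE.
  case=> /andP[iU pi] hi; split=> //; apply/left_endP; split=> // j ji.
  have := hi j ji; rewrite inE; move: pi; rewrite -ji ltnS leq_eqVlt.
  case: (p =P j :> nat) => [/val_inj <- //|_ /= ->]; by rewrite andbT.
case=> /left_endP[iU hi] pi; rewrite iU pi; split=> // j /hi jU.
by rewrite inE (negbTE jU).
Qed.

Lemma component_ltn U p i : p \notin U -> (i < p)%N ->
  component [set l in U | (l < p)%N] i = component U i.
Proof.
move=> pU ip; apply/setP => j; apply/componentP/componentP => -[ij hU]; split=> // l il.
  by have := hU l il; rewrite inE => /andP[].
rewrite inE hU //=; have /andP[_ lj] := il; apply: leq_ltn_trans lj _.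
by rewrite ltnNge; apply: contra pU => pj; apply: hU; rewrite (ltnW ip).
Qed.

Lemma component_gtn U p i : (p < i)%N ->
  component [set l in U | (p < l)%N] i = component U i.
Proof.
move=> pi; apply/setP => j; apply/componentP/componentP => -[ij hU]; split=> // l il.
  by have := hU l il; rewrite inE => /andP[].
by rewrite inE hU //=; have /andP[il' _] := il; apply: leq_trans il'.
Qed.

Lemma sorted_enum_ltn (S : {set 'I_n}) : sorted ltn (map val (enum S)).
Proof.
rewrite -[enum _](eq_filter (mem_enum _)).
rewrite -(eq_filter (mem_map val_inj _)) -filter_map.
by rewrite (sorted_filter ltn_trans) // unlock val_ord_enum iota_ltn_sorted.
Qed.

End Intervals.

(** The order of the factors matters: the positions below p come first because
    r is increasing. *)
Lemma prod_split_ord (R : nzRingType) n (r : seq 'I_n) (P : pred 'I_n)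
    (F : 'I_n -> R) (p : nat) :
  sorted ltn (map val r) ->
  \prod_(i <- r | P i) F i =
  \prod_(i <- r | P i && (i < p)%N) F i * \prod_(i <- r | P i && (p <= i)%N) F i.
Proof.
elim: r => [|i r IH] /=; first by rewrite !big_nil mulr1.
move=> rs; rewrite !big_cons {}IH ?(path_sorted rs) //.
case: (P i) => //=; case: ltnP => pi; first by rewrite mulrA.
rewrite big1_seq ?mul1r // => j /andP[/andP[_ jp] jr].
move: rs; rewrite (path_sortedE ltn_trans) => /andP[/allP/(_ (val j))].
rewrite map_f // => /(_ isT) ij _.
by have := leq_ltn_trans pi (ltn_trans ij jp); rewrite ltnn.
Qed.

Section BarWord.
Variables (k : fieldType) (A : algType k) (n : nat) (a : n.-tuple A).
Local Notation H := (double_tensor A).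

(** The bar word of the connected components of U.  Indexing bar words by sets
    of positions makes removal of a block a set difference. *)
Definition bar (U : {set 'I_n}) : H := remove a (~: U).

Lemma barE U :
  bar U = \prod_(i < n | left_end U i) letters (subword a (component U i)).
Proof. by rewrite /bar /remove setCK. Qed.

(** A missing position cuts the components into those on its left and those on
    its right. *)
Lemma bar_split (U : {set 'I_n}) (p : 'I_n) : p \notin U ->
  bar U = bar [set l in U | (l < p)%N] * bar [set l in U | (p < l)%N].
Proof.
move=> pU; rewrite !barE (prod_split_ord _ _ p); last first.
  by rewrite [index_enum _]unlock -enum_setT sorted_enum_ltn.
congr (_ * _); apply: eq_big => i.
- by rewrite left_end_ltn.
- by move=> /andP[_ ip]; rewrite component_ltn.
- rewrite left_end_gtn // leq_eqVlt; case: (p =P i :> nat) => //= /val_inj <-.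
  by rewrite /left_end (negbTE pU) ltnn.
- case/andP=> [/andP[iU _]]; rewrite leq_eqVlt.
  case: (p =P i :> nat) => /= [/val_inj|_] pi.
    by rewrite pi iU in pU.
  by rewrite component_gtn.
Qed.

Lemma bar0 : bar set0 = 1.
Proof. by rewrite barE big_pred0 // => i; rewrite /left_end inE. Qed.

Lemma counit_bar U : counit (bar U) = (U == set0)%:R.
Proof.
have [->|/set0Pn[i0 i0U]] := eqVneq U set0; first by rewrite bar0 rmorph1.
have [i iU _] := component_ex i0U.
rewrite barE rmorph_prod (bigD1 i) //=.
have ci : i \in component U i.
  case/left_endP: iU => iU _; apply/componentP; split=> // l.
  by rewrite -eqn_leq => /eqP/val_inj <-.
rewrite [counit _]counit_letters ?mul0r // size_subword.
by apply/set0Pn; exists i.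
Qed.

End BarWord.

(** * Peeling an interval of positions *)

(** The coproduct of a subword is indexed by subsets of 'I_#|J|; for a convex J
    they are carried to subsets of J by the increasing bijection [embed],
    which preserves adjacency, hence connected components. *)
Definition embed n (J : {set 'I_n}) (i : 'I_#|J|) : 'I_n := enum_val i.

Section Transport.
Variables (n : nat) (J : {set 'I_n}).
Hypothesis J_convex : forall i j l : 'I_n,
  i \in J -> j \in J -> (i <= l <= j)%N -> l \in J.
Local Notation f := (@embed n J).
Implicit Types (T : {set 'I_#|J|}) (i j l : 'I_#|J|).

Lemma embed_ltn i j : (f i < f j)%N = (i < j)%N.
Proof.
have lt (u v : 'I_#|J|) : (u < v)%N -> (f u < f v)%N.
  move=> uv; have := sorted_ltn_nth ltn_trans 0%N (sorted_enum_ltn J) u v.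
  rewrite !inE size_map -cardE => /(_ (ltn_ord u) (ltn_ord v) uv).
  by rewrite !(nth_map (f u)) -?cardE // -!(enum_val_nth (A := J)).
case: (ltngtP i j) => [/lt//|/lt ji|/val_inj ->]; last by rewrite ltnn.
by apply/negbTE; rewrite -leqNgt ltnW.
Qed.

Lemma embed_leq i j : (f i <= f j)%N = (i <= j)%N.
Proof. by rewrite leqNgt embed_ltn -leqNgt. Qed.

Lemma embed_surj (x : 'I_n) : x \in J -> exists i, x = f i.
Proof. by move=> xJ; exists (enum_rank_in xJ x); rewrite /embed enum_rankK_in. Qed.

(** Convexity is needed here: a gap of J would separate the images of two
    consecutive indices. *)
Lemma embed_succ i j : (f j).+1 = f i <-> j.+1 = i.
Proof.
split=> ji.
  apply/eqP; rewrite eqn_leq -embed_ltn -ji ltnSn /= leqNgt.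
  apply/negP => ji2; have lt := ltn_trans ji2 (ltn_ord i).
  have := embed_ltn (Ordinal lt) i; rewrite ji2 -ji ltnS.
  by rewrite embed_leq /= ltnn.
apply/eqP; rewrite eqn_leq embed_ltn -ji ltnSn /= leqNgt.
apply/negP => ji2; have lt := ltn_trans ji2 (ltn_ord (f i)).
have /embed_surj[l lE] : Ordinal lt \in J.
  by apply: (J_convex (enum_valP j) (enum_valP i)); rewrite /= leqnSn ltnW.
have : (f j < f l)%N by rewrite -lE.
have : (f l < f i)%N by rewrite -lE.
by rewrite !embed_ltn -ji ltnS leqNgt => /negbTE ->.
Qed.

Lemma enum_embed T : enum (f @: T) = map f (enum T).
Proof.
apply: (inj_map val_inj); apply: (irr_sorted_eq ltn_trans ltnn).
- exact: sorted_enum_ltn.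
- rewrite -map_comp; have := sorted_enum_ltn T; rewrite !sorted_map.
  by apply: sub_sorted => i j /=; rewrite embed_ltn.
move=> x; rewrite /=; apply/mapP/mapP => -[y]; rewrite ?mem_enum.
  by case/imsetP=> i iT -> ->; exists (f i) => //; rewrite map_f // mem_enum.
case/mapP=> i; rewrite mem_enum => iT -> ->; exists (f i) => //.
by rewrite mem_enum imset_f.
Qed.

Lemma left_end_embed T i : left_end (f @: T) (f i) = left_end T i.
Proof.
have fI : injective f := @enum_val_inj _ _.
apply/left_endP/left_endP; rewrite (mem_imset _ _ fI) => -[iT h]; split=> // j ji.
  by have := h (f j) ((embed_succ i j).2 ji); rewrite (mem_imset _ _ fI).
apply/imsetP => -[l lT jE]; move: ji; rewrite jE => /embed_succ/h.
by rewrite lT.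
Qed.

Lemma component_embed T i : component (f @: T) (f i) = f @: component T i.
Proof.
have fI : injective f := @enum_val_inj _ _.
apply/setP => x; apply/componentP/imsetP => [[ix h]|[j /componentP[ij h] ->]].
  have /imsetP[j jT xE] : x \in f @: T by apply: h; rewrite ix leqnn.
  exists j => //; apply/componentP; rewrite -embed_leq -xE; split=> // l il.
  by rewrite -(mem_imset _ _ fI) h // xE !embed_leq.
rewrite embed_leq; split=> // y iy.
have /embed_surj[l lE] : y \in J.
  exact: (J_convex (enum_valP i) (enum_valP j)).
by rewrite lE mem_imset // h // -!embed_leq -lE.
Qed.

Lemma embed_setT : f @: setT = J.
Proof.
apply/setP => x; apply/imsetP/idP => [[i _ ->]|/embed_surj[i ->]].
  exact: enum_valP.
by exists i.
Qed.

Lemma map_embed : map f (index_enum 'I_#|J|) = enum J.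
Proof.
by rewrite [index_enum _]unlock -enum_setT -enum_embed embed_setT.
Qed.

Variables (k : fieldType) (A : algType k) (a : n.-tuple A).

Lemma subword_embed T :
  subword (subword a J) T = subword a (f @: T) :> seq A.
Proof.
rewrite /= /image_mem enum_embed -map_comp; apply: eq_map => i /=.
by rewrite (tnth_nth (tnth a (f i))) /= nth_image.
Qed.

Lemma bar_embed T : bar (subword a J) T = bar a (f @: T).
Proof.
rewrite !barE (eq_bigl (fun x => (x \in J) && left_end (f @: T) x)); last first.
  move=> x; rewrite andb_idl // => /left_endP[/imsetP[i _ ->] _].
  exact: enum_valP.
rewrite -[RHS]big_filter_cond deprecated_filter_index_enum -map_embed big_map.
apply: eq_big => i; first by rewrite left_end_embed.
by move=> _; rewrite component_embed subword_embed.
Qed.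

Variable rho : {linear double_tensor A -> k^o}.
Hypothesis rho_inf : infinitesimal_character rho.

(** On an interval, bar J is a single word and this is the formula defining its
    coproduct, without the term S = set0 because rho 1 = 0. *)
Lemma peel_bar_convex : J != set0 ->
  peel rho (bar a J) =
  \sum_(S : {set 'I_n} | (S != set0) && (S \subset J))
    (rho (letters (subword a S)) : k) *: bar a (J :\: S).
Proof.
move=> J0; have fI : injective f := @enum_val_inj _ _.
rewrite -{1}embed_setT -bar_embed /bar setCT remove_set0 ?card_gt0 //.
rewrite peel_letters ?card_gt0 //.
rewrite [RHS](reindex_onto (fun T => f @: T) (fun S => f @^-1: S)) /=; last first.
  move=> S /andP[_ /subsetP SJ]; apply/setP => x.
  apply/imsetP/idP => [[i]|xS]; first by rewrite inE => iS ->.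
  by have [i xE] := embed_surj (SJ x xS); exists i; rewrite // inE -xE.
apply: eq_big => [T|T _].
  have ->: f @: T \subset J.
    by apply/subsetP => x /imsetP[i _ ->]; apply: enum_valP.
  rewrite imset_eq0 andbT; apply/esym/andb_idr => _.
  by apply/eqP/setP => i; rewrite inE mem_imset.
rewrite subword_embed; congr (_ *: _).
rewrite -[T in LHS]setCK -/(bar _ (~: T)) bar_embed /bar; congr (remove a (~: _)).
apply/setP => x; rewrite inE; apply/imsetP/andP.
  case=> i; rewrite inE => iT ->; rewrite mem_imset // iT; split=> //.
  exact: enum_valP.
case=> xT xJ; have [i xE] := embed_surj xJ; exists i => //.
by rewrite inE; apply: contra xT => iT; rewrite xE imset_f.
Qed.
End Transport.

(** * Peeling an arbitrary set of positions *)

Section Between.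
Variable n : nat.
Implicit Types (B C D U S : {set 'I_n}) (a b c p : 'I_n).

Lemma block_leP B C :
  reflect (exists a b c, [/\ a \in B, b \in B, c \in C & (a <= c <= b)%N])
          (block_le B C).
Proof.
apply: (iffP exists_inP) => [[a aB /exists_inP[b bB /exists_inP[c cC acb]]]|].
  by exists a, b, c.
case=> a [b [c [aB bB cC acb]]]; exists a => //.
by apply/exists_inP; exists b => //; apply/exists_inP; exists c.
Qed.

(** The complement of U is what has been removed already; the condition
    ~~ block_le S (~: U) is how S is said to lie in a single connected
    component of U. *)
Lemma Nblock_leCP S U :
  reflect (forall a b c, a \in S -> b \in S -> (a <= c <= b)%N -> c \in U)
          (~~ block_le S (~: U)).
Proof.
apply: (iffP idP) => [/block_leP h a b c aS bS acb|h].
  by apply: contraPT (h) => cU; apply; exists a, b, c; rewrite inE.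
apply/block_leP => -[a [b [c [aS bS]]]].
by rewrite inE => /negP cU acb; apply/cU/(h a b).
Qed.

Lemma Nblock_leC_sub S U : ~~ block_le S (~: U) -> S \subset U.
Proof.
by move=> /Nblock_leCP h; apply/subsetP => a aS; apply: (h a a); rewrite ?leqnn.
Qed.

Lemma Nblock_leC_ltn S U p :
  ~~ block_le S (~: [set l in U | (l < p)%N]) =
  ~~ block_le S (~: U) && (S \subset [set l in U | (l < p)%N]).
Proof.
apply/idP/andP => [h|[/Nblock_leCP h /subsetP SL]]; last first.
  apply/Nblock_leCP => a b c aS bS acb; rewrite inE (h a b) //=.
  have := SL b bS; rewrite inE => /andP[_]; apply: leq_ltn_trans.
  by case/andP: acb.
split; last exact: Nblock_leC_sub.
apply/Nblock_leCP => a b c aS bS acb.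
by have := (Nblock_leCP _ _ h) a b c aS bS acb; rewrite inE => /andP[].
Qed.

Lemma Nblock_leC_gtn S U p : p \notin U -> S != set0 ->
  ~~ block_le S (~: [set l in U | (p < l)%N]) =
  ~~ block_le S (~: U) && ~~ (S \subset [set l in U | (l < p)%N]).
Proof.
move=> pU /set0Pn[x xS]; apply/idP/andP => [h|[h SL]].
  split.
    apply/Nblock_leCP => a b c aS bS acb.
    by have := (Nblock_leCP _ _ h) a b c aS bS acb; rewrite inE => /andP[].
  apply/negP => /subsetP/(_ x xS); have /subsetP/(_ x xS) := Nblock_leC_sub h.
  by rewrite !inE => /andP[_ px] /andP[_]; rewrite ltnNge ltnW.
have [y yS yp] : exists2 y, y \in S & (p < y)%N.
  have /subsetPn[y yS] := SL; rewrite inE (subsetP (Nblock_leC_sub h) _ yS) /=.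
  rewrite -leqNgt leq_eqVlt => /orP[/eqP/val_inj py|py]; last by exists y.
  by rewrite py (subsetP (Nblock_leC_sub h) _ yS) in pU.
move/Nblock_leCP: h => h; apply/Nblock_leCP => a b c aS bS /andP[ac cb].
rewrite inE (h a b) ?ac //=; apply: leq_trans ac.
rewrite ltnNge; apply: contra pU => ap; apply: (h a y) => //.
by rewrite ap ltnW.
Qed.
End Between.

Section PeelBar.
Variables (k : fieldType) (A : algType k) (n : nat) (a : n.-tuple A).
Variable rho : {linear double_tensor A -> k^o}.
Hypothesis rho_inf : infinitesimal_character rho.

(** Induction on the size of U.  If some missing p has elements of U on both
    sides, then bar U is a product and the Leibniz rule applies: a set S in one
    component of U lies either below or above p.  Otherwise U is an interval. *)
Lemma peel_bar (U : {set 'I_n}) :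
  peel rho (bar a U) =
  \sum_(S : {set 'I_n} | (S != set0) && ~~ block_le S (~: U))
    (rho (letters (subword a S)) : k) *: bar a (U :\: S).
Proof.
elim: {U}_.+1 {-2}U (ltnSn #|U|) => // m IH U; rewrite ltnS => Um.
have [->|U0] := eqVneq U set0.
  rewrite bar0 /peel rmorph1 contract_pure (proj1 rho_inf) scale0r big_pred0 //.
  move=> S; have [//|/set0Pn[x xS] /=] := eqVneq S set0.
  by apply: contraTF xS => /Nblock_leC_sub/subsetP SU; apply/negP => /SU; rewrite inE.
have [/existsP[p /and3P[pU]]|Nsplit] := boolP [exists p, [&& p \notin U,
    [exists x in U, (x < p)%N] & [exists y in U, (p < y)%N]]]; last first.
  have U_convex (i j l : 'I_n) : i \in U -> j \in U -> (i <= l <= j)%N -> l \in U.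
    move=> iU jU /andP[il lj]; apply: contraNT Nsplit => lU.
    apply/existsP; exists l; rewrite lU /=; apply/andP; split; apply/exists_inP.
      exists i => //; rewrite ltn_neqAle il andbT.
      by apply: contra lU => /eqP/val_inj <-.
    exists j => //; rewrite ltn_neqAle lj andbT.
    by apply: contra lU => /eqP/val_inj ->.
  rewrite peel_bar_convex //; apply: eq_bigl => S; congr (_ && _).
  apply/idP/idP => [/subsetP SU|]; last exact: Nblock_leC_sub.
  by apply/Nblock_leCP => i j l /SU iU /SU jU; apply: U_convex.
case/exists_inP=> x xU xp /exists_inP[y yU py].
(* p separates U into the nonempty parts L and R. *)
set L := [set l in U | (l < p)%N]; set R := [set l in U | (p < l)%N].
have Lm : (#|L| < m)%N.
  apply: leq_trans Um; apply: proper_card; apply/properP; split.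
    by apply/subsetP => l; rewrite inE => /andP[].
  by exists y; rewrite // inE yU /= -leqNgt ltnW.
have Rm : (#|R| < m)%N.
  apply: leq_trans Um; apply: proper_card; apply/properP; split.
    by apply/subsetP => l; rewrite inE => /andP[].
  by exists x; rewrite // inE xU /= -leqNgt ltnW.
rewrite (bar_split a pU) -/L -/R peelM // (IH L) // (IH R) //.
rewrite mulr_suml mulr_sumr [RHS](bigID (fun S : {set 'I_n} => S \subset L)) /=.
congr (_ + _); apply: eq_big => S.
- by rewrite -andbA -Nblock_leC_ltn.
- case/andP=> _ /Nblock_leC_sub/subsetP SL.
  have pUS : p \notin U :\: S by rewrite inE (negbTE pU) andbF.
  rewrite -scalerAl (bar_split a pUS); congr (_ *: (bar a _ * bar a _)).
    by apply/setP => l; rewrite !inE andbA.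
  apply/setP => l; rewrite !inE; case: (boolP (l \in S)) => //= /SL.
  by rewrite inE => /andP[-> lp] /=; rewrite ltnNge ltnW.
- case: (altP (S =P set0)) => //= S0.
  by rewrite Nblock_leC_gtn.
case/andP=> _ /Nblock_leC_sub/subsetP SR.
have pUS : p \notin U :\: S by rewrite inE (negbTE pU) andbF.
rewrite -scalerAr (bar_split a pUS); congr (_ *: (bar a _ * bar a _)).
  apply/setP => l; rewrite !inE; case: (boolP (l \in S)) => //= /SR.
  by rewrite inE => /andP[-> lp] /=; rewrite ltnNge ltnW.
by apply/setP => l; rewrite !inE andbA.
Qed.
End PeelBar.

(** * Monotone partitions as sequences of blocks *)

Section MonotoneSequences.
Variable n : nat.
Implicit Types (B C D U S : {set 'I_n}) (P : {set {set 'I_n}}) (s : seq {set 'I_n}).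

(** The sequences of sets which [peel] can take off one after the other from
    bar U, leaving the empty bar word. *)
Fixpoint peeling U s :=
  if s is B :: s' then [&& B != set0, ~~ block_le B (~: U) & peeling (U :\: B) s']
  else U == set0.

(** Disjointness of the blocks is implicit: two sets sharing an element are
    related by block_le in both directions. *)
Definition monotone_seq s :=
  [&& set0 \notin s, pairwise (fun B C => ~~ block_le C B) s
    & [set: 'I_n] \subset \bigcup_(B <- s) B].

Lemma block_leU B C D : block_le B (C :|: D) = block_le B C || block_le B D.
Proof.
apply/block_leP/orP => [[a [b [c [aB bB]]]]|].
  by rewrite inE => /orP[cC|cD] acb; [left|right]; apply/block_leP; exists a, b, c.
by case=> /block_leP[a [b [c [aB bB cC acb]]]]; exists a, b, c; rewrite inE cC ?orbT.
Qed.

(** The complement grows by each set which is taken off, and block_le B is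
    additive in its second argument: so the condition at each step amounts to
    one condition for every earlier set, plus the initial one. *)
Lemma peelingE U s :
  peeling U s = [&& set0 \notin s, pairwise (fun B C => ~~ block_le C B) s,
    all (fun B => ~~ block_le B (~: U)) s & U \subset \bigcup_(B <- s) B].
Proof.
elim: s U => [|D s IH] U /=; first by rewrite big_nil subset0.
rewrite IH in_cons negb_or (eq_sym set0) big_cons subDset setCD.
rewrite (eq_all (a2 := predI (fun B => ~~ block_le B (~: U))
  (fun B => ~~ block_le B D))); last by move=> B; rewrite /= block_leU negb_or.
rewrite all_predI; case: (D != set0); case: (set0 \notin s); case: (block_le D _);
  case: (pairwise _ s); case: (all (fun B => ~~ block_le B (~: U)) s);
  by rewrite ?andbF ?andbT.
Qed.

Lemma peeling_setT s : peeling setT s = monotone_seq s.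
Proof.
rewrite peelingE setCT.
have -> : all (fun B => ~~ block_le B set0) s.
  apply/allP => B _; apply/block_leP => -[a [b [c [_ _]]]].
  by rewrite inE.
by [].
Qed.

Lemma block_le_self B C b : b \in B -> b \in C -> block_le B C.
Proof. by move=> bB bC; apply/block_leP; exists b, b, b; rewrite leqnn. Qed.

Lemma monotone_seq_pair s B C : monotone_seq s -> B \in s -> C \in s ->
  block_le C B -> (index C s <= index B s)%N.
Proof.
case/and3P=> _ /(pairwiseP set0) sP _ Bs Cs CB.
rewrite leqNgt; apply/negP => BC.
have := sP (index B s) (index C s); rewrite !inE !index_mem !nth_index // CB.
by move=> /(_ Bs Cs BC).
Qed.

Lemma monotone_seq_uniq s : monotone_seq s -> uniq s.
Proof.
case/and3P=> s0 sP _; elim: s s0 sP => //= B s IH.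
rewrite in_cons negb_or => /andP[B0 s0] /andP[/allP Bs sP].
rewrite IH // andbT; apply/negP => /Bs.
by rewrite eq_sym in B0; have /set0Pn[x xB] := B0; rewrite (block_le_self xB xB).
Qed.

(** Whichever of B and C comes later encloses no element of the other; this
    excludes overlaps as well as crossings. *)
Lemma monotone_seq_anti s B C : monotone_seq s -> B \in s -> C \in s ->
  block_le B C -> block_le C B -> B = C.
Proof.
move=> ms Bs Cs BC CB; have := monotone_seq_pair ms Bs Cs CB.
have := monotone_seq_pair ms Cs Bs BC => h1 h2.
by apply: (index_inj B Bs Cs); apply: anti_leq; rewrite h1 h2.
Qed.

Definition support s : {set {set 'I_n}} := [set B in s].

Lemma monotone_seq_noncrossing s : monotone_seq s -> noncrossing (support s).
Proof.
move=> ms; apply/andP; split.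
  case/and3P: (ms) => s0 _; rewrite bigcup_seq => cov; apply/and3P; split.
  - rewrite eqEsubset subsetT /=; apply: subset_trans cov _.
    by apply/bigcupsP => B Bs; apply: (bigcup_sup B); rewrite inE.
  - apply/trivIsetP => B C; rewrite !inE => Bs Cs; apply: contraR.
    case/pred0Pn => x /andP[/= xB xC]; apply/eqP.
    by apply: (monotone_seq_anti ms Bs Cs);
      apply: block_le_self xC || apply: block_le_self xB.
  - by rewrite inE.
apply/forall_inP => B; rewrite inE => Bs; apply/forall_inP => C; rewrite inE => Cs.
apply/implyP => BC; apply/forall_inP => i iB; apply/forall_inP => l lB.
apply/forall_inP => j jC; apply/forall_inP => m mC.
apply: contra BC => /andP[/andP[ij jl] lm]; apply/eqP.
apply: (monotone_seq_anti ms Bs Cs); apply/block_leP.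
  by exists i, l, j; rewrite iB lB jC (ltnW ij) ltnW.
by exists j, m, l; rewrite jC mC lB (ltnW jl) ltnW.
Qed.

Definition order_of s : {set {set 'I_n} * {set 'I_n}} :=
  [set p | [&& p.1 \in s, p.2 \in s & (index p.1 s <= index p.2 s)%N]].

Lemma order_ofE s B C : B \in s -> C \in s ->
  ((B, C) \in order_of s) = (index B s <= index C s)%N.
Proof. by move=> Bs Cs; rewrite inE /= Bs Cs. Qed.

Lemma monotone_seq_labelling s :
  monotone_seq s -> monotone_labelling (support s) (order_of s).
Proof.
move=> ms; have E B C : B \in support s -> C \in support s ->
    ((B, C) \in order_of s) = (index B s <= index C s)%N.
  by rewrite !inE => Bs Cs; rewrite Bs Cs.
apply/and5P; split; last (apply/andP; split).
- by apply/subsetP => -[B C]; rewrite !inE /= => /and3P[-> ->].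
- by apply/forall_inP => B Bs; rewrite E.
- apply/forall_inP => B Bs; apply/forall_inP => C Cs; rewrite !E //.
  apply/implyP => /anti_leq eBC; apply/eqP.
  by rewrite !inE in Bs Cs; apply: (index_inj B Bs Cs).
- apply/forall_inP => B Bs; apply/forall_inP => C Cs; apply/forall_inP => D Ds.
  by rewrite !E //; apply/implyP => /andP[]; apply: leq_trans.
- apply/forall_inP => B Bs; apply/forall_inP => C Cs; rewrite !E //.
  exact: leq_total.
apply/forall_inP => B Bs; apply/forall_inP => C Cs; rewrite !E //.
by rewrite !inE in Bs Cs; apply/implyP; apply: monotone_seq_pair.
Qed.

Lemma order_of_inj s s' : uniq s -> uniq s' -> support s = support s' ->
  order_of s = order_of s' -> s = s'.
Proof.
move=> us us' /setP ss' /setP rr'.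
have mem_ss' : s =i s' by move=> B; have := ss' B; rewrite !inE.
pose r B C := (B, C) \in order_of s.
have sr t : uniq t -> (forall B C, r B C = ((B, C) \in order_of t)) -> sorted r t.
  move=> ut rt; apply/(sortedP set0) => i it; have it' := ltnW it.
  by rewrite rt order_ofE ?mem_nth // !index_uniq.
apply: (sorted_eq_in (leT := r)).
- move=> B C D Bs Cs Ds; rewrite /r !order_ofE //; exact: leq_trans.
- move=> B C Bs Cs; rewrite /r !order_ofE // => /anti_leq; exact: (index_inj B Bs Cs).
- exact: sr.
- by apply: sr => // B C; rewrite -rr'.
- exact: uniq_perm.
Qed.

(** The sequence is obtained by sorting the blocks along r.  A later block
    enclosing an element of an earlier one would have to precede it in r. *)
Lemma labelling_sort P (r : {set {set 'I_n} * {set 'I_n}}) :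
  partition P [set: 'I_n] -> monotone_labelling P r ->
  exists s, [/\ size s = #|P|, monotone_seq s, support s = P & order_of s = r].
Proof.
move=> /and3P[/eqP Pcov _ P0] /and5P[/subsetP rP rR rA rT /andP[rL rM]].
pose e B C := (B, C) \in r.
have eR : {in P, reflexive e} by move=> B BP; apply: (forall_inP rR).
have eA : {in P &, antisymmetric e}.
  move=> B C BP CP BC; apply/eqP; move/forall_inP/(_ B BP)/forall_inP/(_ C CP): rA.
  by move/implyP; apply.
have eT : {in P & &, transitive e}.
  move=> C B D CP BP DP BC CD.
  move/forall_inP/(_ B BP)/forall_inP/(_ C CP)/forall_inP/(_ D DP): rT.
  by move/implyP; apply; apply/andP.
have eL : {in P &, total e}.
  by move=> B C BP CP; move/forall_inP/(_ B BP)/forall_inP/(_ C CP): rL.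
have eM B C : B \in P -> C \in P -> block_le B C -> e B C.
  by move=> BP CP; move/forall_inP/(_ B BP)/forall_inP/(_ C CP)/implyP: rM.
pose s := sort e (enum P).
have memS B : (B \in s) = (B \in P) by rewrite mem_sort mem_enum.
have us : uniq s by rewrite sort_uniq enum_uniq.
have srt : sorted e s.
  by apply: (sort_sorted_in (P := mem P)) => //; apply/allP => B; rewrite mem_enum.
have sP : support s = P by apply/setP => B; rewrite inE memS.
have eT' : {in s & &, transitive e}.
  by move=> B C D; rewrite !memS; apply: eT.
have eR' : {in s, reflexive e} by move=> B; rewrite memS; apply: eR.
have idx B C : B \in s -> C \in s -> (index B s <= index C s)%N = e B C.
  move=> Bs Cs; apply/idP/idP => [|BC]; first exact: sorted_leq_index_in.
  rewrite leqNgt; apply/negP => CB.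
  have eCB := sorted_ltn_index_in eT' srt _ _ Cs Bs CB.
  have E : B = C by apply: eA; rewrite -?memS // BC eCB.
  by rewrite E ltnn in CB.
exists s; split=> //; first by rewrite size_sort cardE.
  apply/and3P; split; first by rewrite memS.
    apply/(pairwiseP set0) => i j; rewrite !inE => i_s j_s ij.
    apply: contraL ij => le; rewrite -leqNgt.
    have := eM _ _ _ _ le; rewrite -!memS !mem_nth // => /(_ isT isT).
    by rewrite -idx ?mem_nth // !index_uniq.
  rewrite bigcup_seq -Pcov /cover; apply/bigcupsP => B BP.
  by apply: (bigcup_sup B); rewrite // memS.
apply/setP => -[B C]; rewrite inE /=; apply/and3P/idP => [[Bs Cs]|BC].
  by rewrite idx.
by have := rP _ BC; rewrite inE /= -!memS => /andP[Bs Cs]; split; rewrite // idx.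
Qed.

(** A sequence and the order of appearance of its terms determine each
    other. *)
Lemma nb_labellingsE P j : partition P [set: 'I_n] -> #|P| = j ->
  nb_labellings P =
  #|[set t : j.-tuple {set 'I_n} | monotone_seq t && (support t == P)]|.
Proof.
move=> Ppart Pj.
rewrite -(card_in_imset (f := fun t : j.-tuple {set 'I_n} => order_of t)); last first.
  move=> t t'; rewrite !inE => /andP[mt /eqP tP] /andP[mt' /eqP t'P] tt'.
  apply: val_inj; apply: order_of_inj tt'; rewrite ?monotone_seq_uniq //.
  by rewrite tP.
congr #|pred_of_set _|; apply/setP => r; rewrite inE; apply/idP/imsetP.
  move=> mr; have [s [ss ms sP sr]] := labelling_sort Ppart mr.
  have sj : size s == j by rewrite ss Pj.
  by exists (Tuple sj); rewrite // inE ms sP eqxx.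
case=> t; rewrite inE => /andP[mt /eqP <-] ->; exact: monotone_seq_labelling.
Qed.

Lemma support_card s : monotone_seq s -> #|support s| = size s.
Proof.
move=> /monotone_seq_uniq us; rewrite -(card_uniqP us); apply: eq_card => B.
by rewrite inE.
Qed.

Lemma sum_monotone_seq (R : comNzRingType) (F : {set 'I_n} -> R) j :
  \sum_(t : j.-tuple {set 'I_n} | monotone_seq t) \prod_(B <- t) F B =
  \sum_(P | noncrossing P && (#|P| == j)) (nb_labellings P)%:R * \prod_(B in P) F B.
Proof.
rewrite (partition_big (fun t : j.-tuple _ => support t)
  (fun P => noncrossing P && (#|P| == j))) /=; last first.
  by move=> t mt; rewrite monotone_seq_noncrossing // support_card // size_tuple eqxx.
apply: eq_bigr => P /andP[/andP[Ppart _] /eqP Pj].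
rewrite (nb_labellingsE Ppart Pj) mulr_natl -sumr_const.
apply: eq_big => [t|t /andP[mt /eqP <-]]; first by rewrite inE.
rewrite big_uniq ?monotone_seq_uniq //; apply: eq_bigl => B.
by rewrite inE.
Qed.
End MonotoneSequences.

(** * The monotone expansion of the convolution powers *)

Section MonotoneExpansion.
Variables (k : fieldType) (A : algType k) (n : nat) (a : n.-tuple A).
Variable rho : {linear double_tensor A -> k^o}.
Hypothesis rho_inf : infinitesimal_character rho.

Lemma conv_pow_bar j (U : {set 'I_n}) :
  conv_pow rho j (bar a U) =
  \sum_(t : j.-tuple {set 'I_n} | peeling U t)
    \prod_(B <- t) rho (letters (subword a B)) :> k.
Proof.
elim: j U => [|j IH] U.
  rewrite [LHS]counit_bar; have [U0|U0] := eqVneq U set0.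
    rewrite (big_pred1 [tuple]) ?big_nil // => t.
    by rewrite tuple0 /= U0 !eqxx.
  by rewrite big_pred0 // => t; rewrite tuple0 /= (negbTE U0).
rewrite conv_powS peel_bar // linear_sum.
(* A sequence of length j.+1 is a pair (head, tail). *)
rewrite [RHS](reindex (fun p : {set 'I_n} * j.-tuple {set 'I_n} =>
  [tuple of p.1 :: p.2])) /=; last first.
  exists (fun t => (thead t, [tuple of behead t])) => [[B t] _|t _].
    by rewrite theadE; congr (_, _); apply: val_inj.
  by rewrite -tuple_eta.
under eq_bigr => B _ do rewrite linearZ /= IH /GRing.scale /= mulr_sumr.
rewrite pair_big_dep; apply: eq_big => -[B t] /=; first by rewrite andbA.
by rewrite big_cons.
Qed.

(** The whole word is bar [n]. *)
Lemma conv_pow_letters j : (0 < n)%N ->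
  conv_pow rho j (letters a) =
  \sum_(P | noncrossing P && (#|P| == j))
    (nb_labellings P)%:R *
    block_product (fun n (a : n.-tuple A) => rho (letters a)) P a :> k.
Proof.
move=> n0; rewrite -(remove_set0 a n0) -setCT -/(bar a setT) conv_pow_bar.
rewrite -(sum_monotone_seq (fun B => rho (letters (subword a B)) : k)).
by apply: eq_bigl => t; rewrite peeling_setT.
Qed.

Lemma noncrossing_card (P : {set {set 'I_n}}) : (0 < n)%N ->
  noncrossing P -> (0 < #|P| < n.+1)%N.
Proof.
move=> n0 /andP[Ppart _]; have /and3P[/eqP cov _ P0] := Ppart; apply/andP; split.
  rewrite card_gt0; apply: contraTneq n0 => PE; rewrite -leqNgt.
  by rewrite -[n in (n <= _)%N]card_ord -cardsT -cov PE /cover big_set0 cards0.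
rewrite ltnS -[n in (_ <= n)%N]card_ord -cardsT (card_partition Ppart) -sum1_card.
apply: leq_sum => B BP; rewrite card_gt0.
by apply: contraNneq P0 => <-.
Qed.

(** The exponential series is finite on a word with n letters since a partition
    of [n] has at most n blocks; its term of degree 0 is the counit, which is 0
    there. *)
Lemma exp_star_letters : (0 < n)%N ->
  exp_star rho (letters a) =
  \sum_(1 <= s < n.+1) s`!%:R^-1 * \sum_(P | noncrossing P && (#|P| == s))
    (nb_labellings P)%:R *
    block_product (fun n (a : n.-tuple A) => rho (letters a)) P a.
Proof.
move=> n0; rewrite /exp_star (fsbigE (index_iota 0 n.+1)); first last;
  [|by []|exact: iota_uniq|].
  move=> j _; rewrite mem_index_iota /= => jn.
  rewrite conv_pow_letters // big_pred0 ?mulr0 // => P.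
  apply: contraNF jn => /andP[/(noncrossing_card n0)/andP[_ Pn] /eqP <-].
  exact: Pn.
rewrite (eq_bigl predT); last by move=> j; rewrite mem_setT.
have E0 : conv_pow rho 0 (letters a) = 0.
  by apply: counit_letters; rewrite size_tuple.
rewrite [LHS]big_ltn // [X in _ = X]/= E0 mulr0 [LHS]add0r.
by apply: eq_bigr => j _; rewrite conv_pow_letters.
Qed.
End MonotoneExpansion.

(** * The moment-cumulant relation *)

Section SumOverPartitions.
Variables (k : fieldType) (A : algType k).

Lemma sum_monotone_partition (h : form_family A) n (a : n.-tuple A) :
  \sum_(g | @monotone_partition n g) (#|g.1|)`!%:R^-1 * block_product h g.1 a =
  \sum_(P | @noncrossing n P)
    (#|P|)`!%:R^-1 * ((nb_labellings P)%:R * block_product h P a).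
Proof.
under [RHS]eq_bigr => P _ do
  rewrite /nb_labellings mulrCA mulr_natl -sumr_const.
rewrite pair_big_dep; apply: eq_bigl => -[P r] /=.
by rewrite inE.
Qed.

Lemma sum_by_nb_blocks n (F : {set {set 'I_n}} -> k) : (0 < n)%N ->
  \sum_(1 <= s < n.+1) s`!%:R^-1 * \sum_(P | @noncrossing n P && (#|P| == s)) F P =
  \sum_(P | @noncrossing n P) (#|P|)`!%:R^-1 * F P.
Proof.
move=> n0; under eq_bigr => s _ do rewrite mulr_sumr.
rewrite (exchange_big_dep (@noncrossing n)) /=; last by move=> s P _ /andP[].
apply: eq_bigr => P nP; have sP := noncrossing_card n0 nP.
rewrite (eq_bigl (pred1 #|P|)) => [|s]; last by rewrite nP eq_sym.
by rewrite -big_filter filter_pred1_uniq ?iota_uniq ?mem_index_iota // big_seq1.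
Qed.

(** Transport along an equality of lengths, for blocks of size #|setT| = n. *)
Lemma form_family_eq (h : form_family A) m n (b : m.-tuple A) (a : n.-tuple A) :
  m = n -> b = a :> seq A -> h m b = h n a.
Proof. by move=> mn; case: n / mn a => a ba; congr (h m _); apply: val_inj. Qed.

Lemma noncrossing_one n : (0 < n)%N -> noncrossing [set [set: 'I_n]].
Proof.
move=> n0; apply/andP; split.
  apply/and3P; split; first by rewrite /cover big_set1.
    by apply/trivIsetP => B C; rewrite !inE => /eqP -> /eqP ->; rewrite eqxx.
  by rewrite inE eq_sym -card_gt0 cardsT card_ord.
apply/forall_inP => B /set1P ->; apply/forall_inP => C /set1P ->.
by rewrite eqxx.
Qed.

Lemma nb_labellings_one n : (0 < n)%N -> nb_labellings [set [set: 'I_n]] = 1%N.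
Proof.
move=> n0; rewrite (@nb_labellingsE _ _ 1) ?cards1 //; last first.
  by case/andP: (noncrossing_one n0).
apply: (@eq_card1 _ [tuple [set: 'I_n]]) => t.
rewrite !inE; apply/andP/eqP => [[_ /eqP]|->]; last first.
  split; last by apply/eqP/setP => B; rewrite !inE.
  rewrite /monotone_seq /= big_seq1 subxx inE eq_sym -card_gt0 cardsT card_ord n0.
  by [].
case: t => -[|B [|? ?]] //= sz /setP/(_ B); rewrite !inE eqxx => /esym/eqP BT.
by apply: val_inj; rewrite /= BT.
Qed.

Lemma set_letter_cat n (a : n.-tuple A) (i : 'I_n) x :
  set_letter a i x = take i a ++ x :: drop i.+1 a :> seq A.
Proof.
have sz : size (take i a ++ x :: drop i.+1 a) = n.
  rewrite size_cat size_takel /= ?size_drop size_tuple; last exact: ltnW.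
  by rewrite -addSnnS subnKC.
apply: (@eq_from_nth _ x) => [|j]; rewrite size_tuple ?sz // => jn.
have -> := esym (tnth_nth x (set_letter a i x) (Ordinal jn)).
rewrite tnth_mktuple -val_eqE /= nth_cat size_takel ?size_tuple; last exact: ltnW.
case: (ltngtP j i) => [ji|ij|->]; last by rewrite subnn.
  by rewrite nth_take // (tnth_nth x).
by rewrite -[(j - i)%N]prednK ?subn_gt0 //= nth_drop -subnS subnKC // (tnth_nth x).
Qed.

Lemma multilinear_rho_letters (rho : {linear double_tensor A -> k^o}) :
  multilinear_family (fun n (a : n.-tuple A) => rho (letters a)).
Proof.
move=> n a i c x y; rewrite !set_letter_cat letters_multi.
exact: linearP.
Qed.

(** Induction on n: in the difference of the two relations, only the terms of
    the one-block partition remain, and its coefficient is 1. *)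
Lemma monotone_cumulants_unique (phi : A -> k) (h h' : form_family A) :
  monotone_cumulants phi h -> monotone_cumulants phi h' ->
  forall n (a : n.-tuple A), (0 < n)%N -> h' n a = h n a.
Proof.
move=> [_ hE] [_ h'E] n; elim/ltn_ind: n => n IH a n0.
have := h'E n a n0; rewrite (hE n a n0) !sum_monotone_partition.
rewrite (bigD1 [set [set: 'I_n]]) ?noncrossing_one //=.
rewrite [in RHS](bigD1 [set [set: 'I_n]]) ?noncrossing_one //=.
set r := (X in _ + X = _); set r' := (X in _ = _ + X).
have -> : r' = r.
  apply: eq_bigr => P /andP[/andP[Ppart _] Pn1]; congr (_ * (_ * _)).
  apply: eq_bigr => B BP; have /and3P[/eqP cov tiv P0] := Ppart.
  apply: IH; last by rewrite card_gt0; apply: contraNneq P0 => <-.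
  rewrite -[n in (_ < n)%N]card_ord -cardsT ltn_neqAle subset_leq_card ?subsetT //.
  rewrite andbT; apply: contra Pn1 => /eqP Bn.
  have BT : B = setT by apply/eqP; rewrite eqEcard subsetT Bn /=.
  apply/eqP/setP => C; rewrite inE -BT; apply/idP/eqP => [CP|->//].
  apply/eqP; apply: contraNT P0 => CB; move/trivIsetP/(_ C B CP BP CB): tiv.
  by rewrite BT -setI_eq0 setIT => /eqP <-.
move/addIr; rewrite /block_product !big_set1 cards1 nb_labellings_one // invr1 !mul1r.
have E (g : form_family A) : g #|[set: 'I_n]| (subword a setT) = g n a.
  by apply: form_family_eq; rewrite ?cardsT ?card_ord ?subword_setT.
by rewrite !E.
Qed.

End SumOverPartitions.

Theorem theorem4 (k : fieldType) (char0 : [pchar k] =i pred0) (A : algType k)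
  (phi : {linear A -> k^o}) (phi1 : phi 1 = 1)
  (rho : {linear double_tensor A -> k^o})
  (rho_inf : infinitesimal_character rho)
  (rho_exp : forall x, Phi phi x = exp_star rho x) :
  let h : form_family A := fun n a => rho (letters a) in
  (forall (n : nat) (a : n.-tuple A), (0 < n)%N ->
    Phi phi (letters a) =
    \sum_(1 <= s < n.+1) (s`!%:R^-1 *
      \sum_(g : {set {set 'I_n}} | noncrossing g && (#|g| == s))
        (nb_labellings g)%:R * block_product h g a)) /\
  monotone_cumulants phi h /\
  (forall h' : form_family A, monotone_cumulants phi h' ->
    forall (n : nat) (a : n.-tuple A), (0 < n)%N -> h' n a = h n a).
Proof.
move=> h.
have PhiE n (a : n.-tuple A) : (0 < n)%N -> Phi phi (letters a) =
    \sum_(1 <= s < n.+1) (s`!%:R^-1 *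
      \sum_(g : {set {set 'I_n}} | noncrossing g && (#|g| == s))
        (nb_labellings g)%:R * block_product h g a).
  by move=> n0; rewrite rho_exp exp_star_letters.
have hcum : monotone_cumulants phi h.
  split=> [|n a n0]; first exact: multilinear_rho_letters.
  rewrite sum_monotone_partition.
  rewrite -(sum_by_nb_blocks
    (fun P => (nb_labellings P)%:R * block_product h P a)) // -PhiE //.
  by rewrite Phi_letters ?size_tuple // big_tuple.
split=> //; split=> // h' h'cum; exact: (monotone_cumulants_unique hcum h'cum).
Qed.
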